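(* Let $(A_n)$ be a sequence of real $n\times n$ matrices with $\mathrm{Tr}(A_n^TA_n)=n$, and suppose that \[\lim_{n\to\infty}\frac{1}{n^2}\sum_{i\neq j}(A_n)_{ii}(A_n)_{jj}=c\] for some constant $c$. Let $M$ be an $n\times n$ Haar-distributed random orthogonal matrix and $C_n$ the permutation matrix of the $n$-cycle $(1,2,\dots,n)$. Then \[\mathrm{Tr}(A_nMC_nM^T)\xrightarrow{d}\mathcal{N}(0,1-c)\quad\text{as } n\to\infty.\]
   Context: Haar measure on $O(n)$ is the unique left- and right-invariant probability measure. $C_n$ is the $n\times n$ matrix with $(C_n)_{i,i+1}=1$ for all $i$ (indices mod $n$, so $(C_n)_{n,1}=1$) and all other entries $0$; thus $(MC_nM^T)_{ab}=\sum_{i=1}^n M_{a,i}M_{b,i+1}$ with $M_{b,n+1}:=M_{b,1}$. *)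

(* Defs.v *)
From HB Require Import structures.
From mathcomp Require Import all_boot all_order all_algebra.
From mathcomp Require Import all_classical all_reals all_analysis.
Set Implicit Arguments. Unset Strict Implicit. Unset Printing Implicit Defensive.
Import Order.TTheory GRing.Theory Num.Theory.
Import numFieldNormedType.Exports.
Local Open Scope classical_set_scope.
Local Open Scope ring_scope.

Definition cycle_mx (R : nzRingType) (n : nat) : 'M[R]_n :=
  \matrix_(i < n, j < n) ((j == ordS i)%:R).

Definition orthogonal_mx (R : realType) (n : nat) (U : 'M[R]_n) : Prop :=
  U *m U^T = 1%:M.

Definition bounded_continuous (R : realType) (X : topologicalType) (f : X -> R) : Prop :=
  continuous f /\ exists K : R, forall x, `|f x| <= K.

(* M : T -> 'M_n is a Haar-distributed random orthogonal matrix on (T, P):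
   measurable entries, almost surely orthogonal, and its law is invariant under
   left and right multiplication by orthogonal matrices (law equality is
   expressed through all bounded continuous test functions on 'M_n). *)
Definition haar_orthogonal (R : realType) (d : measure_display) (T : measurableType d)
  (P : probability T R) (n : nat) (M : T -> 'M[R]_n) : Prop :=
  [/\ (forall i j, measurable_fun setT (fun w => M w i j)),
      P [set w | orthogonal_mx (M w)] = 1%E &
      forall U V : 'M[R]_n, orthogonal_mx U -> orthogonal_mx V ->
      forall g : 'M[R]_n -> R, bounded_continuous g ->
        (\int[P]_w (g (U *m M w *m V))%:E = \int[P]_w (g (M w))%:E)%E].

(* E[f(Z)] for Z ~ N(0, v), v >= 0, written as E[f(sqrt v * G)] with G standard
   normal (so that v = 0 gives the point mass at 0) *)
Definition normal_expect (R : realType) (v : R) (f : R -> R) : \bar R :=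
  (\int[@lebesgue_measure R]_x (f (Num.sqrt v * x) * normal_pdf 0 1 x)%:E)%E.

(* Main.v *)
Require Import Defs.
From HB Require Import structures.
From mathcomp Require Import all_boot all_order all_algebra.
From mathcomp Require Import ring lra zify.
From mathcomp Require Import all_classical all_reals all_analysis.
From mathcomp Require Import measurable_realfun.
Set Implicit Arguments. Unset Strict Implicit. Unset Printing Implicit Defensive.
Import Order.TTheory GRing.Theory Num.Theory.
Import numFieldNormedType.Exports.
Local Open Scope classical_set_scope.
Local Open Scope ring_scope.

(** Stein's method driven by the invariance of Haar measure. Write
    [B = M C M^T] and let [S] be the traceless part of [A], so that
    [Tr (A B) = Tr (S B) =: F]. Differentiating [E (h (e^(tX) M)) = E (h M)] at
    [t = 0] for [h = phi(F) * D_X F], and summing over the basis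
    [X = E_ij - E_ji] of the skew matrices, gives
      [E (phi'(F) (|S|^2 + err)) = E (phi(F) ((n - 1) F + Tr (S^T B)))]
    with [err = Tr(B^2 S^2) - Tr(B S B S) - Tr(B S B^T S^T)]. Since [B] is
    orthogonal and traceless, the same integration by parts with [phi = id],
    applied to [F] and to the traces in [err] themselves, shows that [F] has
    bounded second moment and [err] has second moment [O(n)]. As
    [|S|^2 / n --> 1 - c], [F] satisfies Stein's characterisation of
    [N(0, 1 - c)] up to [O(n^(-1/2))], and testing against the solution of
    Stein's equation for [f] concludes (when [c = 1], the second moment of [F]
    already tends to [0]). *)

(** Everything rests on coercivity: the second-order operator obtained by summing over the skew
    basis multiplies F by a constant of order n, up to a term in B^T, so a second moment is bounded
    by a squared gradient divided by about n. The pathwise bound on err is only of order n, as large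
    as |S|^2 may be; the missing factor sqrt n comes from applying the same coercivity to each trace
    in err. The second derivatives of these traces contain products of linear traces, so the
    quadratic case rests on the linear one. Leading coefficients stay clean because Tr S = 0, Tr C =
    0 and, for Tr(B^2 S^2), which is linear in the conjugate of C^2, Tr C^2 = 0; hence the
    restriction n > 2. Centering also produces the variance: |S|^2 = n - (Tr A)^2 / n, and (Tr A)^2
    differs from the off-diagonal sum of the hypothesis by the sum of the A_ii^2, at most n. An
    analytic obstacle is that polynomials in the entries are unbounded on the space of all matrices,
    while invariance is given for bounded continuous functions; hence M is modified on a null set
    and functions are truncated at their bound on the group. *)

Lemma mxtraceN (R : pzRingType) (n : nat) (P : 'M[R]_n) : \tr (- P) = - \tr P.
Proof. exact: raddfN. Qed.

Lemma mxtraceB (R : pzRingType) (n : nat) (P Q : 'M[R]_n) :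
  \tr (P - Q) = \tr P - \tr Q.
Proof. exact: raddfB. Qed.

(** * Hilbert-Schmidt norms and sums over skew matrices *)

Section HilbertSchmidt.
Variables (R : rcfType) (n : nat).
Implicit Types (P Q U : 'M[R]_n).

Definition hs P : R := \tr (P *m P^T).

Lemma trace_mulmx P Q : \tr (P *m Q) = \sum_i \sum_j P i j * Q j i.
Proof. by apply: eq_bigr => i _; rewrite mxE. Qed.

Lemma hsE P : hs P = \sum_i \sum_j P i j ^+ 2.
Proof.
by rewrite /hs trace_mulmx; do 2!apply: eq_bigr => ? _; rewrite mxE -expr2.
Qed.

Lemma hs_ge0 P : 0 <= hs P.
Proof. by rewrite hsE; do 2!apply: sumr_ge0 => ? _; exact: sqr_ge0. Qed.

Lemma hs_tr P : hs P^T = hs P.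
Proof. by rewrite /hs trmxK mxtrace_mulC. Qed.

Lemma hsN P : hs (- P) = hs P.
Proof. by rewrite /hs linearN /= mulNmx mulmxN opprK. Qed.

Lemma hsD P Q : hs (P + Q) = hs P + \tr (P *m Q^T) *+ 2 + hs Q.
Proof.
rewrite /hs linearD /= mulmxDl !mulmxDr !mxtraceD.
have -> : \tr (Q *m P^T) = \tr (P *m Q^T) by rewrite -mxtrace_tr trmx_mul trmxK.
by ring.
Qed.

Lemma trace_mulmx_tr_le P Q : `|\tr (P *m Q^T)| *+ 2 <= hs P + hs Q.
Proof.
have := hs_ge0 (P + Q); have := hs_ge0 (P - Q).
rewrite !hsD hsN linearN /= mulmxN mxtraceN => h1 h2.
by case: (ger0P (\tr (P *m Q^T))) => _; lra.
Qed.

Lemma trace_mulmx_le P Q : `|\tr (P *m Q)| *+ 2 <= hs P + hs Q.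
Proof. by rewrite -(hs_tr Q) -{1}[Q]trmxK trace_mulmx_tr_le. Qed.

Lemma hsD_le P Q : hs (P + Q) <= (hs P + hs Q) *+ 2.
Proof.
have := trace_mulmx_tr_le P Q; rewrite hsD.
have := ler_norm (\tr (P *m Q^T)); lra.
Qed.

(** Lagrange's identity: the deficit is half the sum of the squares of all minors
    [x i * y j - x j * y i]. *)
Lemma cauchy_schwarz_sum (I : finType) (x y : I -> R) :
  (\sum_i x i * y i) ^+ 2 <= (\sum_i x i ^+ 2) * (\sum_i y i ^+ 2).
Proof.
rewrite -subr_ge0.
have -> : (\sum_i x i ^+ 2) * (\sum_i y i ^+ 2) - (\sum_i x i * y i) ^+ 2 =
    2^-1 * \sum_i \sum_j (x i * y j - x j * y i) ^+ 2.
  have -> : \sum_i \sum_j (x i * y j - x j * y i) ^+ 2 =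
     \sum_i \sum_j x i ^+ 2 * y j ^+ 2 + \sum_i \sum_j x j ^+ 2 * y i ^+ 2
     - 2 * \sum_i \sum_j (x i * y i) * (x j * y j).
    rewrite mulr_sumr -big_split -sumrB; apply: eq_bigr => i _ /=.
    rewrite mulr_sumr -big_split -sumrB; apply: eq_bigr => j _ /=.
    by ring.
  rewrite [X in _ + X - _]exchange_big /=.
  rewrite -!big_distrlr /=.
  by field.
rewrite mulr_ge0 ?invr_ge0 ?ler0n//; do 2!apply: sumr_ge0 => ? _.
exact: sqr_ge0.
Qed.

Lemma hs_mul P Q : hs (P *m Q) <= hs P * hs Q.
Proof.
rewrite !hsE [X in _ <= _ * X]exchange_big big_distrlr /=.
do 2!apply: ler_sum => ? _; rewrite mxE.
exact: cauchy_schwarz_sum.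
Qed.

Lemma hs_orthol U P : U *m U^T = 1%:M -> hs (U *m P) = hs P.
Proof.
move=> oU; rewrite /hs trmx_mul mulmxA mxtrace_mulC !mulmxA (mulmx1C oU) mul1mx.
by [].
Qed.

Lemma hs_orthor U P : U *m U^T = 1%:M -> hs (P *m U) = hs P.
Proof. by move=> oU; rewrite /hs trmx_mul mulmxA -(mulmxA P) oU mulmx1. Qed.

Lemma trace_mulmx_norm_le P Q a : hs P = a -> hs Q = a -> `|\tr (P *m Q)| <= a.
Proof. by move=> pa qa; have := trace_mulmx_le P Q; rewrite pa qa; lra. Qed.

Lemma trace_tr_mulmx_norm_le P Q a :
  hs P = a -> hs Q = a -> `|\tr (P^T *m Q)| <= a.
Proof. by move=> pa qa; apply: trace_mulmx_norm_le; rewrite ?hs_tr. Qed.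

End HilbertSchmidt.

Section SkewBasis.
Variables (R : rcfType) (n : nat).
Implicit Types (P Q K B S : 'M[R]_n) (i j k l : 'I_n).

(** Sums below run over all ordered pairs: the diagonal gives 0 and each unordered pair counts
    twice, as the summands are even in X. This is the source of the factors 2 in the sums. *)
Definition skew i j : 'M[R]_n := delta_mx i j - delta_mx j i.

Lemma skew_tr i j : (skew i j)^T = - skew i j.
Proof. by rewrite /skew linearB /= !trmx_delta opprB. Qed.

(** For distinct i and j the square is minus the projection onto the plane of the coordinates i and
    j. The cubic relation gives the exponential a closed form. *)
Lemma skew_cube i j : skew i j *m skew i j *m skew i j = - skew i j.
Proof.
rewrite /skew; have [->|ij] := eqVneq i j; first by rewrite subrr !mulmx0 oppr0.
have ji : (j == i) = false by rewrite eq_sym (negbTE ij).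
have eij : (i == j) = false by rewrite (negbTE ij).
do 4!rewrite ?mulmxBl ?mulmxBr ?mul_delta_mx_cond ?eqxx ?eij ?ji /= ?mulr0n ?mulr1n
  ?mul0mx ?mulmx0 ?subr0 ?sub0r ?mulNmx ?mulmxN ?opprK.
by rewrite addr0 opprB addrC.
Qed.

Lemma trace_delta K i j : \tr (delta_mx i j *m K) = K j i.
Proof.
rewrite trace_mulmx (bigD1 i) //= (bigD1 j) //= !mxE !eqxx mul1r.
rewrite !big1 ?addr0 // => k.
  by move=> ki; rewrite big1 // => l _; rewrite mxE (negbTE ki) mul0r.
by move=> kj; rewrite mxE (negbTE kj) andbF mul0r.
Qed.

Lemma trace_delta2 P Q i j k l :
  \tr (delta_mx i j *m P *m delta_mx k l *m Q) = P j k * Q l i.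
Proof.
rewrite -!mulmxA trace_delta mxE (bigD1 k) //= mxE (bigD1 l) //= mxE !eqxx mul1r.
rewrite !big1 ?addr0 // => m.
  move=> mk; rewrite mxE big1 ?mulr0 // => p _.
  by rewrite mxE (negbTE mk) mul0r.
by move=> ml; rewrite mxE (negbTE ml) andbF mul0r.
Qed.

Lemma trace_tr_mulmx P Q : \tr (P^T *m Q) = \sum_i \sum_j P j i * Q j i.
Proof. by rewrite trace_mulmx; do 2!apply: eq_bigr => ? _; rewrite mxE. Qed.

(** Contraction over the basis: of the four products of matrix units, the two with equal units pair
    P with Q entrywise, and the two with opposite units split into diagonal entries. The sums of
    nested and of double brackets below reduce to this one. *)
Lemma sum_skew2 P Q :
  \sum_i \sum_j \tr (skew i j *m P *m skew i j *m Q) =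
  2 * (\tr (P^T *m Q) - \tr P * \tr Q).
Proof.
have -> : \sum_i \sum_j \tr (skew i j *m P *m skew i j *m Q) =
  \sum_i \sum_j P j i * Q j i + \sum_i \sum_j P i j * Q i j
  - \sum_i \sum_j P i i * Q j j - \sum_i \sum_j P j j * Q i i.
  rewrite -big_split -!sumrB; apply: eq_bigr => i _ /=.
  rewrite -big_split -!sumrB; apply: eq_bigr => j _ /=.
  rewrite /skew !(mulmxBl, mulmxBr) !mxtraceB !trace_delta2.
  by ring.
rewrite [X in _ + X - _ - _]exchange_big [X in _ - X = _]exchange_big /=.
by rewrite -trace_tr_mulmx -!big_distrlr /= /mxtrace; ring.
Qed.

(** Each trace is K_ji - K_ij, so only the skew part of K is seen; the right-hand side is
    [hs (K - K^T)]. *)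
Lemma sum_skew_sqr K :
  \sum_i \sum_j \tr (skew i j *m K) ^+ 2 = 2 * (hs K - \tr (K *m K)).
Proof.
have -> : \sum_i \sum_j \tr (skew i j *m K) ^+ 2 =
  \sum_i \sum_j K j i ^+ 2 + \sum_i \sum_j K i j ^+ 2
  - 2 * \sum_i \sum_j K i j * K j i.
  rewrite mulr_sumr -big_split -!sumrB; apply: eq_bigr => i _ /=.
  rewrite mulr_sumr -big_split -!sumrB; apply: eq_bigr => j _ /=.
  by rewrite /skew mulmxBl mxtraceB !trace_delta; ring.
rewrite [X in X + _ - _]exchange_big /=.
by rewrite -hsE -trace_mulmx; ring.
Qed.

Lemma sum_skew_sqr_le K : \sum_i \sum_j \tr (skew i j *m K) ^+ 2 <= 4 * hs K.
Proof.
rewrite sum_skew_sqr; have := trace_mulmx_le K K.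
have := ler_norm (- \tr (K *m K)); rewrite normrN; lra.
Qed.

(** The nested bracket is X^2 B - 2 X B X + B X^2. The squares X^2 sum to the scalar -2 (n - 1), and
    X B X sums to a multiple of B^T because the term in Tr B drops out: B is an eigenvector up to
    its transpose. *)
Lemma sum_skew_bracket2 B S : \tr B = 0 ->
  \sum_i \sum_j \tr ((skew i j *m (skew i j *m B - B *m skew i j)
      - (skew i j *m B - B *m skew i j) *m skew i j) *m S) =
  - 4 * (n%:R - 1) * \tr (B *m S) - 4 * \tr (B^T *m S).
Proof.
move=> B0.
have -> : \sum_i \sum_j \tr ((skew i j *m (skew i j *m B - B *m skew i j)
      - (skew i j *m B - B *m skew i j) *m skew i j) *m S) =
  \sum_i \sum_j \tr (skew i j *m 1%:M *m skew i j *m (B *m S))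
  + \sum_i \sum_j \tr (skew i j *m 1%:M *m skew i j *m (S *m B))
  - 2 * \sum_i \sum_j \tr (skew i j *m B *m skew i j *m S).
  rewrite mulr_sumr -big_split -!sumrB; apply: eq_bigr => i _ /=.
  rewrite mulr_sumr -big_split -!sumrB; apply: eq_bigr => j _ /=.
  move: (skew i j) => X; rewrite !mulmx1 !(mulmxBl, mulmxBr) !mxtraceB !mulmxA.
  have -> : \tr (X *m X *m S *m B) = \tr (B *m X *m X *m S).
    by rewrite mxtrace_mulC !mulmxA.
  by ring.
rewrite !sum_skew2 trmx1 !mul1mx mxtrace1 B0 (mxtrace_mulC S B); ring.
Qed.

(** Mixed part of the second derivative of a trace quadratic in B. The hypotheses on S1 and S2
    remove the products of traces in which one of them stands alone. *)
Lemma sum_skew_bracket_bracket B1 B2 S1 S2 :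
  \tr S1 = 0 -> \tr S2 = 0 ->
  \sum_i \sum_j \tr ((skew i j *m B1 - B1 *m skew i j) *m S1 *m
                     (skew i j *m B2 - B2 *m skew i j) *m S2) =
  2 * (\tr ((B1 *m S1)^T *m (B2 *m S2)) - \tr (B1 *m S1) * \tr (B2 *m S2)
     + \tr ((S1 *m B2)^T *m (S2 *m B1)) - \tr (S1 *m B2) * \tr (S2 *m B1)
     - \tr ((B1 *m S1 *m B2)^T *m S2) - \tr (S1^T *m (B2 *m S2 *m B1))).
Proof.
move=> S10 S20.
have -> : \sum_i \sum_j \tr ((skew i j *m B1 - B1 *m skew i j) *m S1 *m
                     (skew i j *m B2 - B2 *m skew i j) *m S2) =
  \sum_i \sum_j \tr (skew i j *m (B1 *m S1) *m skew i j *m (B2 *m S2))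
  + \sum_i \sum_j \tr (skew i j *m (S1 *m B2) *m skew i j *m (S2 *m B1))
  - \sum_i \sum_j \tr (skew i j *m (B1 *m S1 *m B2) *m skew i j *m S2)
  - \sum_i \sum_j \tr (skew i j *m S1 *m skew i j *m (B2 *m S2 *m B1)).
  rewrite -big_split -!sumrB; apply: eq_bigr => i _ /=.
  rewrite -big_split -!sumrB; apply: eq_bigr => j _ /=.
  move: (skew i j) => X; rewrite !(mulmxBl, mulmxBr) !mxtraceB !mulmxA.
  rewrite (mxtrace_mulC _ B1) (mxtrace_mulC _ B1) !mulmxA.
  by ring.
rewrite !sum_skew2 S10 S20; ring.
Qed.

End SkewBasis.

(** * Rotations and derivatives along them *)

Section OrthogonalGroup.
Variables (R : realType) (n : nat).
Implicit Types (M N U V : 'M[R]_n).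

Lemma orthogonal_mx1 : orthogonal_mx (1%:M : 'M[R]_n).
Proof. by rewrite /orthogonal_mx trmx1 mulmx1. Qed.

Lemma orthogonal_mx_tr U : orthogonal_mx U -> orthogonal_mx U^T.
Proof. by move=> oU; rewrite /orthogonal_mx trmxK; exact: mulmx1C. Qed.

Lemma orthogonal_mxM U V :
  orthogonal_mx U -> orthogonal_mx V -> orthogonal_mx (U *m V).
Proof.
move=> oU oV; rewrite /orthogonal_mx trmx_mul mulmxA -(mulmxA U) oV mulmx1.
exact: oU.
Qed.

Lemma orthogonal_mx_entry_le U i j : orthogonal_mx U -> `|U i j| <= 1.
Proof.
move=> oU; have : (U *m U^T) i i = 1 by rewrite oU mxE eqxx.
rewrite mxE (bigD1 j) //= mxE => eU.
rewrite -(ler_pXn2r (ltn0Sn 1)) ?nnegrE // expr1n -normrX ger0_norm ?sqr_ge0 //.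
rewrite -eU expr2 lerDl; apply: sumr_ge0 => k _; rewrite mxE -expr2.
exact: sqr_ge0.
Qed.

(* Rodrigues' formula: the one-parameter group generated by [X] when
   [X^3 = - X]. *)
Definition rot (X : 'M[R]_n) (t : R) : 'M[R]_n :=
  1%:M + sin t *: X + (1 - cos t) *: (X *m X).

(** Transposition flips the sign of the sine term. By the cubic relation the product reduces to 1, X
    and X^2: the terms in X cancel, and X^2 gets the coefficient 1 - cos^2 - sin^2. *)
Lemma rot_orthogonal X t : X^T = - X -> X *m X *m X = - X ->
  orthogonal_mx (rot X t).
Proof.
move=> XT X3.
have RT : (rot X t)^T = 1%:M - sin t *: X + (1 - cos t) *: (X *m X).
  apply/matrixP => i j; rewrite !mxE eq_sym.
  have := congr1 (fun Z : 'M[R]_n => Z i j) XT; rewrite !mxE => ->.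
  have -> : \sum_k X j k * X k i = \sum_k X i k * X k j.
    apply: eq_bigr => k _.
    have := congr1 (fun Z : 'M[R]_n => Z k j) XT.
    have := congr1 (fun Z : 'M[R]_n => Z i k) XT; rewrite !mxE => -> ->.
    by rewrite mulrNN mulrC.
  by ring.
rewrite /orthogonal_mx RT /rot.
have X4 : X *m X *m (X *m X) = - (X *m X) by rewrite mulmxA X3 mulNmx.
have X3' : X *m (X *m X) = - X by rewrite mulmxA X3.
rewrite !mulmxDl !mulmxDr !mulmxN !mul1mx !mulmx1 -!scalemxAl -!scalemxAr.
rewrite X3 X3' X4.
move: (X *m X) => Y.
apply/matrixP => i j; rewrite !mxE.
have := sin2cos2 t; set c := cos t; set s := sin t => cs.
transitivity ((i == j)%:R + Y i j * ((1 - c ^+ 2) - s ^+ 2)); first by ring.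
by rewrite cs; ring.
Qed.

Lemma rot0 X : rot X 0 = 1%:M.
Proof. by rewrite /rot sin0 cos0 subrr !scale0r !addr0. Qed.

End OrthogonalGroup.

Section RealDerivatives.
Variable R : realType.
Implicit Types (f g : R -> R) (x a b : R).

Lemma is_derive1_add f g x a b : is_derive x 1 f a -> is_derive x 1 g b ->
  is_derive x 1 (fun t => f t + g t) (a + b).
Proof. by move=> fa gb; exact: is_deriveD. Qed.

Lemma is_derive1_mul f g x a b : is_derive x 1 f a -> is_derive x 1 g b ->
  is_derive x 1 (fun t => f t * g t) (a * g x + f x * b).
Proof.
move=> fa gb; have := is_deriveM fa gb.
by move/is_derive_eq; apply; rewrite /GRing.scale /= addrC (mulrC a).
Qed.

Lemma is_derive1_sum (I : Type) (r : seq I) (F : I -> R -> R) (A : I -> R) x :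
  (forall i, is_derive x 1 (F i) (A i)) ->
  is_derive x 1 (fun t => \sum_(i <- r) F i t) (\sum_(i <- r) A i).
Proof.
move=> FA; elim: r => [|i r IH].
  rewrite big_nil (_ : (fun _ => _) = cst 0); first exact: is_derive_cst.
  by apply/funext => t; rewrite big_nil.
rewrite big_cons (_ : (fun _ => _) = fun t => F i t + \sum_(j <- r) F j t).
  exact: is_derive1_add.
by apply/funext => t; rewrite big_cons.
Qed.

Lemma is_derive1_continuous f df :
  (forall x, is_derive x 1 f (df x)) -> continuous f.
Proof.
move=> fdf x; apply: differentiable_continuous; apply/derivable1_diffP.
exact: (@ex_derive _ _ _ _ _ _ _ (fdf x)).
Qed.

End RealDerivatives.

Section MatrixDerivatives.
Variables (R : realType) (n : nat).
Implicit Types (Phi Psi : R -> 'M[R]_n) (A B : 'M[R]_n) (t : R).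

Definition mx_derive t Phi A :=
  forall i j, is_derive t 1 (fun s => Phi s i j) (A i j).

Lemma mx_derive_cst t A : mx_derive t (fun=> A) 0.
Proof. by move=> i j; rewrite mxE; exact: is_derive_cst. Qed.

Lemma mx_derive_tr t Phi A : mx_derive t Phi A ->
  mx_derive t (fun s => (Phi s)^T) A^T.
Proof.
move=> PA i j; rewrite mxE (_ : (fun _ => _) = fun s => Phi s j i) //.
by apply/funext => s; rewrite mxE.
Qed.

Lemma mx_deriveD t Phi Psi A B : mx_derive t Phi A -> mx_derive t Psi B ->
  mx_derive t (fun s => Phi s + Psi s) (A + B).
Proof.
move=> PA PB i j; rewrite mxE (_ : (fun _ => _) = fun s => Phi s i j + Psi s i j).
  exact: is_derive1_add.
by apply/funext => s; rewrite mxE.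
Qed.

Lemma mx_deriveN t Phi A : mx_derive t Phi A -> mx_derive t (fun s => - Phi s) (- A).
Proof.
move=> PA i j; rewrite mxE (_ : (fun _ => _) = - (fun s => Phi s i j)).
  exact: is_deriveN.
by apply/funext => s; rewrite mxE.
Qed.

Lemma mx_deriveB t Phi Psi A B : mx_derive t Phi A -> mx_derive t Psi B ->
  mx_derive t (fun s => Phi s - Psi s) (A - B).
Proof. by move=> PA PB; apply: mx_deriveD => //; exact: mx_deriveN. Qed.

Lemma mx_deriveM t Phi Psi A B : mx_derive t Phi A -> mx_derive t Psi B ->
  mx_derive t (fun s => Phi s *m Psi s) (A *m Psi t + Phi t *m B).
Proof.
move=> PA PB i j.
rewrite (_ : (fun _ => _) = fun s => \sum_k Phi s i k * Psi s k j); last first.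
  by apply/funext => s; rewrite mxE.
rewrite !mxE -big_split /=.
apply: is_derive1_sum => k; exact: is_derive1_mul.
Qed.

Lemma is_derive_trace t Phi A : mx_derive t Phi A ->
  is_derive t 1 (fun s => \tr (Phi s)) (\tr A).
Proof. by move=> PA; rewrite /mxtrace; apply: is_derive1_sum => i; exact: PA. Qed.

Lemma mx_derive_rot (X : 'M[R]_n) t : X *m X *m X = - X ->
  mx_derive t (rot X) (X *m rot X t).
Proof.
move=> X3 i j.
have -> : X *m rot X t = cos t *: X + sin t *: (X *m X).
  rewrite /rot !mulmxDr mulmx1 -!scalemxAr mulmxA X3.
  by apply/matrixP => k l; rewrite !mxE; ring.
rewrite /rot; move: (X *m X) {X3} => Y.
rewrite (_ : (fun s => _) =
    fun s => (i == j)%:R + sin s * X i j + (1 - cos s) * Y i j); last first.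
  by apply/funext => s; rewrite !mxE.
rewrite !mxE.
have d1 : is_derive t 1 (fun s => sin s * X i j) (cos t * X i j).
  have := is_derive1_mul (is_derive_sin t) (is_derive_cst (X i j) t 1).
  by move/is_derive_eq; apply; rewrite mulr0 addr0.
have d2 : is_derive t 1 (fun s => (1 - cos s) * Y i j) (sin t * Y i j).
  have d3 : is_derive t 1 (fun s => 1 - cos s) (0 - (- sin t)).
    exact: (is_deriveB (is_derive_cst (1 : R) t 1) (is_derive_cos t)).
  have := is_derive1_mul d3 (is_derive_cst (Y i j) t 1).
  by move/is_derive_eq; apply; rewrite mulr0 addr0 sub0r opprK.
have := is_derive1_add (is_derive1_add (is_derive_cst ((i == j)%:R : R) t 1) d1) d2.
by rewrite add0r.
Qed.

Definition conjby (D N : 'M[R]_n) := N *m D *m N^T.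

(** The derivative at any t is the commutator with X taken at the moved point [rot X t *m N], so a
    second differentiation is the same computation again. *)
Lemma mx_derive_conj (X D N : 'M[R]_n) t : X^T = - X -> X *m X *m X = - X ->
  mx_derive t (fun s => conjby D (rot X s *m N))
    (X *m conjby D (rot X t *m N) - conjby D (rot X t *m N) *m X).
Proof.
move=> XT X3.
have dU : mx_derive t (fun s => rot X s *m N) (X *m (rot X t *m N)).
  have := mx_deriveM (mx_derive_rot t X3) (mx_derive_cst t N).
  by rewrite mulmx0 addr0 -mulmxA.
have := mx_deriveM (mx_deriveM dU (mx_derive_cst t D)) (mx_derive_tr dU).
by rewrite mulmx0 addr0 (trmx_mul X) XT !mulmxN /conjby !mulmxA.
Qed.

End MatrixDerivatives.

(** * A class of test functions closed under polynomial operations *)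

Section TestFunctions.
Variables (R : realType) (n : nat).
Implicit Types (F G : 'M[R]_n -> R) (Phi Psi : 'M[R]_n -> 'M[R]_n).

(** Measurability is asked after composition with any entrywise measurable random matrix, which
    avoids a sigma-algebra on matrices. The bound is asked on orthogonal matrices only, so that
    polynomials in the entries qualify. *)
Definition test_fun F : Prop :=
  [/\ continuous F,
      (forall (d : measure_display) (T : measurableType d) (M : T -> 'M[R]_n),
        (forall i j, measurable_fun setT (fun w => M w i j)) ->
        measurable_fun setT (fun w => F (M w)))
    & exists C : R, forall N, orthogonal_mx N -> `|F N| <= C].

Lemma test_fun_cst c : test_fun (fun=> c).
Proof.
split; [exact: cst_continuous|by move=> *; exact: measurable_cst|].
by exists `|c|.
Qed.

Lemma test_funD F G : test_fun F -> test_fun G -> test_fun (fun N => F N + G N).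
Proof.
move=> [cF mF [a aF]] [cG mG [b bG]]; split.
- by move=> N; exact: (cvgD (cF N) (cG N)).
- by move=> d T M mM; apply: measurable_funD; [exact: mF|exact: mG].
exists (a + b) => N oN; rewrite (le_trans (ler_normD _ _)) // lerD //.
  exact: aF.
exact: bG.
Qed.

Lemma test_funM F G : test_fun F -> test_fun G -> test_fun (fun N => F N * G N).
Proof.
move=> [cF mF [a aF]] [cG mG [b bG]]; split.
- by move=> N; exact: (cvgM (cF N) (cG N)).
- by move=> d T M mM; apply: measurable_funM; [exact: mF|exact: mG].
by exists (a * b) => N oN; rewrite normrM ler_pM //; [exact: aF|exact: bG].
Qed.

Lemma test_funN F : test_fun F -> test_fun (fun N => - F N).
Proof.
move=> tF; under eq_fun do rewrite -mulN1r.
by apply: test_funM => //; exact: test_fun_cst.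
Qed.

Lemma test_funX F k : test_fun F -> test_fun (fun N => F N ^+ k).
Proof.
move=> tF; elim: k => [|k IH]; first exact: test_fun_cst.
by under eq_fun do rewrite exprS; exact: test_funM.
Qed.

(** On orthogonal matrices F takes its values in a compact interval, where a continuous [phi] is
    bounded; so unbounded choices such as the identity are allowed. *)
Lemma test_fun_comp (phi : R -> R) F : continuous phi -> test_fun F ->
  test_fun (fun N => phi (F N)).
Proof.
move=> cphi [cF mF [a aF]]; split.
- by move=> N; apply: (@continuous_comp _ _ _ F phi); [exact: cF|exact: cphi].
- move=> d T M mM; apply: (measurableT_comp (continuous_measurable_fun cphi)).
  exact: mF.
have [K bK] : exists K, forall x, `|x| <= a -> `|phi x| <= K.
  have cpt : compact (phi @` `[- a, a]).
    apply: continuous_compact; last exact: segment_compact.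
    by apply: continuous_subspaceT.
  have [K [_ HK]] := compact_bounded cpt.
  exists (K + 1) => x xa; apply: (HK (K + 1)); first by rewrite ltrDl.
  by exists x => //=; rewrite in_itv /= -ler_norml.
by exists K => N oN; apply: bK; exact: aF.
Qed.

Lemma test_fun_sum (I : Type) (r : seq I) (F : I -> 'M[R]_n -> R) :
  (forall i, test_fun (F i)) -> test_fun (fun N => \sum_(i <- r) F i N).
Proof.
move=> tF; elim: r => [|i r IH].
  by under eq_fun do rewrite big_nil; exact: test_fun_cst.
by under eq_fun do rewrite big_cons; exact: test_funD.
Qed.

Definition test_mx Phi := forall i j, test_fun (fun N => Phi N i j).

Lemma test_mx_cst A : test_mx (fun=> A).
Proof. by move=> i j; exact: test_fun_cst. Qed.

Lemma test_mx_id : test_mx id.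
Proof.
move=> i j; split; [exact: coord_continuous|by move=> d T M mM|].
by exists 1 => N oN; exact: orthogonal_mx_entry_le.
Qed.

Lemma test_mx_tr Phi : test_mx Phi -> test_mx (fun N => (Phi N)^T).
Proof. by move=> tP i j; under eq_fun do rewrite mxE; exact: tP. Qed.

Lemma test_mxD Phi Psi : test_mx Phi -> test_mx Psi ->
  test_mx (fun N => Phi N + Psi N).
Proof. by move=> tP tQ i j; under eq_fun do rewrite mxE; exact: test_funD. Qed.

Lemma test_mxN Phi : test_mx Phi -> test_mx (fun N => - Phi N).
Proof.
move=> tP i j; under eq_fun do rewrite mxE -mulN1r.
by apply: test_funM => //; exact: test_fun_cst.
Qed.

Lemma test_mxM Phi Psi : test_mx Phi -> test_mx Psi ->
  test_mx (fun N => Phi N *m Psi N).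
Proof.
move=> tP tQ i j; under eq_fun do rewrite mxE.
by apply: test_fun_sum => k; exact: test_funM.
Qed.

Lemma test_mx_conj D : test_mx (conjby D).
Proof.
rewrite /conjby; apply: test_mxM; last by apply: test_mx_tr; exact: test_mx_id.
by apply: test_mxM; [exact: test_mx_id|exact: test_mx_cst].
Qed.

Lemma test_fun_trace Phi : test_mx Phi -> test_fun (fun N => \tr (Phi N)).
Proof. by move=> tP; rewrite /mxtrace; apply: test_fun_sum => i; exact: tP. Qed.

End TestFunctions.

(** * Integration by parts for Haar measure *)

Section EverywhereHaar.
Variables (R : realType) (n : nat).
Variables (d : measure_display) (T : measurableType d) (P : probability T R).
Implicit Types (M : T -> 'M[R]_n) (F : 'M[R]_n -> R).

(** Orthogonality at every point makes every test function bounded along M, hence integrable,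
    although it may be unbounded elsewhere. *)
Definition haar_everywhere M : Prop :=
  [/\ (forall i j, measurable_fun setT (fun w => M w i j)),
      (forall w, orthogonal_mx (M w)) &
      forall U, orthogonal_mx U -> forall F, test_fun F ->
        \int[P]_w F (U *m M w) = \int[P]_w F (M w)].

Lemma hs_eq0 (Q : 'M[R]_n) : hs Q = 0 -> Q = 0.
Proof.
rewrite hsE => h; apply/matrixP => i j; rewrite mxE.
have h1 := psumr_eq0P (fun i _ => sumr_ge0 _ (fun j _ => sqr_ge0 (Q i j))) h.
have := psumr_eq0P (fun j _ => sqr_ge0 (Q i j)) (h1 i isT).
by move=> /(_ j isT)/eqP; rewrite sqrf_eq0 => /eqP.
Qed.

(** The set is the preimage of 0 under the polynomial test function [hs (N *m N^T - 1%:M)]. *)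
Lemma measurable_orthogonal M :
  (forall i j, measurable_fun setT (fun w => M w i j)) ->
  measurable [set w | orthogonal_mx (M w)].
Proof.
move=> mM.
pose F (N : 'M[R]_n) := hs (N *m N^T - 1%:M).
have [_ mF _] : test_fun F.
  have t1 : test_mx (fun N : 'M[R]_n => N *m N^T - 1%:M).
    apply: test_mxD; last exact: test_mx_cst.
    by apply: test_mxM; [|apply: test_mx_tr]; exact: test_mx_id.
  by apply: test_fun_trace; apply: test_mxM => //; exact: test_mx_tr.
have := mF _ _ M mM measurableT [set 0] (measurable_set1 _).
rewrite setTI; congr measurable; apply/seteqP; split => w /=; rewrite /F.
  by move/hs_eq0/eqP; rewrite subr_eq0 => /eqP.
by rewrite /orthogonal_mx => ->; rewrite subrr /hs mul0mx mxtrace0.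
Qed.

(** M is replaced by the identity matrix on the null set where it is not orthogonal, which changes
    no integral. *)
Lemma haar_orthogonal_everywhere M : haar_orthogonal P M ->
  exists M', haar_everywhere M' /\
    forall F, test_fun F ->
      (\int[P]_w (F (M w))%:E = \int[P]_w (F (M' w))%:E)%E.
Proof.
move=> [mM oM inv].
have mO := measurable_orthogonal mM.
pose M' w := if `[< orthogonal_mx (M w) >] then M w else 1%:M.
have mM' i j : measurable_fun setT (fun w => M' w i j).
  rewrite (_ : (fun _ => _) =
    fun w => if `[< orthogonal_mx (M w) >] then M w i j else (1%:M : 'M[R]_n) i j).
    apply: measurable_fun_ifT => //.
    apply: (@measurable_fun_bool _ _ _ _ true); rewrite setTI.
    rewrite (_ : _ @^-1` _ = [set w | orthogonal_mx (M w)]) //.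
    by apply/seteqP; split => w /= /asboolP.
  by apply/funext => w; rewrite /M'; case: ifP.
have oM' w : orthogonal_mx (M' w).
  by rewrite /M'; case: asboolP => // _; exact: orthogonal_mx1.
have aeE (g : 'M[R]_n -> \bar R) : measurable_fun setT (fun w => g (M w)) ->
    measurable_fun setT (fun w => g (M' w)) ->
    (\int[P]_w g (M w) = \int[P]_w g (M' w))%E.
  move=> m1 m2; apply: ae_eq_integral => //.
  exists (~` [set w | orthogonal_mx (M w)]); split.
  - exact: measurableC.
  - by have := probability_setC P mO; rewrite oM subee.
  - move=> w /= h oMw; apply: h => _; congr g; rewrite /M'.
    by case: asboolP.
exists M'; split; last first.
  move=> F [cF mF _]; apply: (aeE (fun N => (F N)%:E)).
    by apply/measurable_EFinP; exact: mF.
  by apply/measurable_EFinP; exact: mF.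
split => // U oU F tF.
have [cF mF [C bF]] := tF.
(* The assumed invariance concerns globally bounded functions, while F is bounded by C on orthogonal
   matrices only. Truncation at C gives a bounded continuous function that agrees with F there. *)
pose clip (x : R) := Num.max (- C) (Num.min C x).
have cclip : continuous clip.
  move=> x; apply: (@continuous_max R R (cst (- C)) (cst C \min id) x).
    exact: cst_continuous.
  by apply: (@continuous_min R R (cst C) id x); [exact: cst_continuous|exact: cvg_id].
have clipE x : `|x| <= C -> clip x = x.
  by rewrite ler_norml => /andP[a b]; rewrite /clip (min_idPr b) (max_idPr a).
have C0 : 0 <= C by apply: le_trans (bF _ (@orthogonal_mx1 _ _)).
have [cG mG _] := test_fun_comp cclip tF.
have bG : bounded_continuous (fun N => clip (F N)).
  split => //; exists C => N; rewrite /clip ler_norml; apply/andP; split.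
    by rewrite le_max lexx.
  by rewrite ge_max ge_min lexx /= andbT; lra.
have mUM (L : T -> 'M[R]_n) : (forall i j, measurable_fun setT (fun w => L w i j)) ->
    forall i j, measurable_fun setT (fun w => (U *m L w) i j).
  move=> mL i j.
  have [_ + _] := test_mxM (test_mx_cst U) (@test_mx_id R n) i j.
  exact.
congr fine.
transitivity (\int[P]_w (clip (F (U *m M' w)))%:E)%E.
  by apply: eq_integral => w _; rewrite clipE //; apply: bF; exact: orthogonal_mxM.
transitivity (\int[P]_w (clip (F (M' w)))%:E)%E; last first.
  by apply: eq_integral => w _; rewrite clipE //; apply: bF.
rewrite -(aeE (fun N => (clip (F (U *m N)))%:E)); last 2 first.
  by apply/measurable_EFinP; apply: mG; exact: mUM.
  by apply/measurable_EFinP; apply: mG; exact: mUM.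
rewrite -(aeE (fun N => (clip (F N))%:E)); last 2 first.
  by apply/measurable_EFinP; apply: mG.
  by apply/measurable_EFinP; apply: mG.
rewrite -(inv U 1%:M oU (@orthogonal_mx1 _ _) _ bG).
by apply: eq_integral => w _; rewrite mulmx1.
Qed.

End EverywhereHaar.

Section BoundedExpectation.
Variables (R : realType) (n : nat).
Variables (d : measure_display) (T : measurableType d) (P : probability T R).
Variable M : T -> 'M[R]_n.
Hypothesis haarM : haar_everywhere P M.
Implicit Types F G : 'M[R]_n -> R.

Definition Ex F : R := \int[P]_w F (M w).

Lemma test_fun_integrable F : test_fun F ->
  P.-integrable setT (EFin \o (fun w => F (M w))).
Proof.
move=> [_ mF [C bF]]; have [mM oM _] := haarM.
apply: measurable_bounded_integrable => //.
- by apply: le_lt_trans (ltry 1); exact: probability_le1.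
- exact: mF.
exists C; split; first exact: num_real.
by move=> x Cx w _ /=; apply: le_trans (ltW Cx); exact: bF.
Qed.

Lemma ExD F G : test_fun F -> test_fun G ->
  Ex (fun N => F N + G N) = Ex F + Ex G.
Proof. by move=> tF tG; apply: RintegralD => //; exact: test_fun_integrable. Qed.

Lemma ExZ a F : test_fun F -> Ex (fun N => a * F N) = a * Ex F.
Proof. by move=> tF; apply: RintegralZl => //; exact: test_fun_integrable. Qed.

Lemma Ex_cst a : Ex (fun=> a) = a.
Proof.
rewrite /Ex Rintegral_cst // (_ : _ setT = 1%E) ?mulr1 //.
exact: probability_setT.
Qed.

Lemma le_Ex F G : test_fun F -> test_fun G ->
  (forall N, orthogonal_mx N -> F N <= G N) -> Ex F <= Ex G.
Proof.
move=> tF tG FG; have [_ oM _] := haarM.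
apply: le_Rintegral => //; [exact: test_fun_integrable..|].
by move=> w _; exact: FG.
Qed.

Lemma eq_Ex F G : (forall N, orthogonal_mx N -> F N = G N) -> Ex F = Ex G.
Proof.
by move=> FG; have [_ oM _] := haarM; apply: eq_Rintegral => w _; exact: FG.
Qed.

Lemma Ex_sum (I : Type) (r : seq I) (F : I -> 'M[R]_n -> R) :
  (forall i, test_fun (F i)) ->
  Ex (fun N => \sum_(i <- r) F i N) = \sum_(i <- r) Ex (F i).
Proof.
move=> tF; elim: r => [|i r IH].
  by rewrite big_nil -[RHS](Ex_cst 0); apply: eq_Ex => N _; rewrite big_nil.
rewrite big_cons -IH -ExD //; last exact: test_fun_sum.
by apply: eq_Ex => N _; rewrite big_cons.
Qed.

Lemma mean_value_le (u du : R -> R) (K t : R) : 0 < t ->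
  (forall s : R, is_derive s 1 u (du s)) -> (forall s, `|du s| <= K) ->
  `|u t - u 0| <= K * t.
Proof.
move=> t0 dU bK.
have [] := @MVT R u du 0 t t0 (fun s _ => dU s).
  apply: derivable_within_continuous => s _; exact: (@ex_derive _ _ _ _ _ _ _ (dU s)).
move=> c _ ->; rewrite subr0 normrM (gtr0_norm t0).
by rewrite ler_wpM2r // ltW.
Qed.

(** The derivative is taken along the steps 1 / (k + 1), since dominated convergence is applied to a
    sequence. *)
Lemma cvg_harmonic_quotient (u : R -> R) (a : R) : is_derive (0 : R) 1 u a ->
  (fun k => k.+1%:R * (u k.+1%:R^-1 - u 0)) @ \oo --> a.
Proof.
move=> [du ua].
have h : (fun k => k.+1%:R^-1 : R) @ \oo --> (0 : R)^'.
  move=> A /= [e e0 eA].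
  have := @cvg_harmonic R => /cvgrPdist_lt/(_ e e0)[N _ HN].
  exists N => // k /= /HN hk; apply: eA; first exact: hk.
  by apply: invr_neq0; rewrite pnatr_eq0.
have h2 : h^-1 *: ((u \o shift 0) (h *: 1) - u 0) @[h --> 0^'] --> a.
  by rewrite -ua.
have := cvg_comp _ _ h h2.
apply: cvg_trans; apply: near_eq_cvg; near=> k => /=.
by rewrite invrK addr0 /GRing.scale /= mulr1.
Unshelve. all: by end_near. Qed.

(* The expectation of [h (rot X t *m M)] does not depend on [t]; differentiate at
   [t = 0] under the integral. *)
Lemma haar_derivative X (h dh : 'M[R]_n -> R) : X^T = - X -> X *m X *m X = - X ->
  test_fun h -> test_fun dh ->
  (forall N (t : R), is_derive t 1 (fun s => h (rot X s *m N)) (dh (rot X t *m N))) ->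
  Ex dh = 0.
Proof.
move=> XT X3 th tdh hdh.
have [mM oM inv] := haarM.
have [_ mdh [K bK]] := tdh.
have [_ mh _] := th.
have oR t := rot_orthogonal t XT X3.
pose q k w := k.+1%:R * (h (rot X k.+1%:R^-1 *m M w) - h (M w)).
have mRM t i j : measurable_fun setT (fun w => (rot X t *m M w) i j).
  have [_ + _] := test_mxM (test_mx_cst (rot X t)) (@test_mx_id R n) i j.
  exact.
have mhR t : measurable_fun setT (fun w => h (rot X t *m M w)) by exact: mh.
have mq k : measurable_fun setT (q k).
  by apply: measurable_funM => //; apply: measurable_funB => //; exact: mh.
(* Domination: the orbit [rot X s *m M w] stays in the orthogonal group, where [dh] is bounded by K,
   so the mean value inequality bounds every quotient by K. *)
have bq k w : `|q k w| <= K.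
  have k0 : 0 < k.+1%:R^-1 :> R by rewrite invr_gt0.
  have := mean_value_le k0 (hdh (M w)) (fun s => bK _ (orthogonal_mxM (oR s) (oM w))).
  rewrite rot0 mul1mx => h1; rewrite /q normrM normr_nat mulrC.
  by rewrite -ler_pdivlMr.
(* By invariance every difference quotient already has mean zero, hence so has its limit. *)
have iq k : \int[P]_w q k w = 0.
  have i1 : P.-integrable setT (EFin \o (fun w => h (rot X k.+1%:R^-1 *m M w))).
    apply: measurable_bounded_integrable => //.
      by apply: le_lt_trans (ltry 1); exact: probability_le1.
    have [_ _ [C bC]] := th.
    exists C; split; first exact: num_real.
    move=> x Cx w _ /=; apply: le_trans (ltW Cx); apply: bC.
    exact: orthogonal_mxM.
  rewrite /q RintegralZl //; last first.
    exact: (integrableB measurableT i1 (test_fun_integrable th)).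
  rewrite RintegralB //; last exact: test_fun_integrable.
  by rewrite inv // subrr mulr0.
have cq w : q k w @[k --> \oo] --> dh (M w).
  have := cvg_harmonic_quotient (hdh (M w) 0).
  by rewrite rot0 mul1mx.
have [] := @dominated_convergence _ T R P setT measurableT
  (fun k w => (q k w)%:E) (fun w => (dh (M w))%:E) (cst K%:E).
- by move=> k; apply/measurable_EFinP.
- by apply/measurable_EFinP; exact: mdh.
- by apply: aeW => w _; apply: cvg_EFin; [exact: nearW|exact: cq].
- exact: finite_measure_integrable_cst.
- by apply: aeW => w k _; rewrite /= lee_fin.
move=> _ _ cv; rewrite /Ex /Rintegral.
suff -> : (\int[P]_w (dh (M w))%:E = 0)%E by [].
apply/esym/(cvg_unique _ _ cv); first exact: ereal_hausdorff.
rewrite (_ : (fun _ => _) = cst 0%E); first exact: cvg_cst.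
apply/funext => k /=.
have /eqP := iq k; rewrite /Rintegral fine_eq0 => [/eqP //|].
apply: integrable_fin_num => //; apply: measurable_bounded_integrable => //.
  by apply: le_lt_trans (ltry 1); exact: probability_le1.
exists K; split; first exact: num_real.
by move=> x Kx w _ /=; apply: le_trans (ltW Kx).
Qed.

Lemma haar_ibp X (F DF DDF : 'M[R]_n -> R) (phi dphi : R -> R) :
  X^T = - X -> X *m X *m X = - X ->
  test_fun F -> test_fun DF -> test_fun DDF ->
  (forall x : R, is_derive x 1 phi (dphi x)) -> continuous dphi ->
  (forall N (t : R),
    is_derive t 1 (fun s => F (rot X s *m N)) (DF (rot X t *m N))) ->
  (forall N (t : R),
    is_derive t 1 (fun s => DF (rot X s *m N)) (DDF (rot X t *m N))) ->
  Ex (fun N => dphi (F N) * DF N ^+ 2 + phi (F N) * DDF N) = 0.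
Proof.
move=> XT X3 tF tDF tDDF dp cdp dF ddF.
have cp := is_derive1_continuous dp.
apply: (@haar_derivative X (fun N => phi (F N) * DF N)) => //.
- by apply: test_funM => //; exact: test_fun_comp.
- apply: test_funD; apply: test_funM => //; try exact: test_fun_comp.
  exact: test_funX.
move=> N t.
have dc : is_derive t 1 (fun s => phi (F (rot X s *m N)))
    (dphi (F (rot X t *m N)) * DF (rot X t *m N)).
  have := is_derive1_comp (dp (F (rot X t *m N))) (dF N t).
  by [].
have := is_derive1_mul dc (ddF N t).
by move/is_derive_eq; apply; rewrite expr2 mulrA.
Qed.

End BoundedExpectation.

Ltac test_solve := repeat lazymatch goal with
  | |- test_fun (fun _ => ?c) => exact (test_fun_cst _ c)
  | |- test_fun (fun N => \tr (@?F N)) => apply (@test_fun_trace _ _ F)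
  | |- test_fun (fun N => @?F N + @?G N) => apply (@test_funD _ _ F G)
  | |- test_fun (fun N => - @?F N) => apply (@test_funN _ _ F)
  | |- test_fun (fun N => @?F N * @?G N) => apply (@test_funM _ _ F G)
  | |- test_fun (fun N => @?F N ^+ ?k) => apply (@test_funX _ _ F k)
  | |- test_fun (fun N => \sum_(i <- ?r) @?F N i) =>
      apply (@test_fun_sum _ _ _ r (fun i N => F N i)); intro
  | |- test_mx (fun _ => ?A) => exact (test_mx_cst A)
  | |- test_mx (fun N => N) => exact (@test_mx_id _ _)
  | |- test_mx (conjby ?D) => exact (test_mx_conj D)
  | |- test_mx (fun N => conjby ?D N) => exact (test_mx_conj D)
  | |- test_mx (fun N => @?F N *m @?G N) => apply (@test_mxM _ _ F G)
  | |- test_mx (fun N => @?F N + @?G N) => apply (@test_mxD _ _ F G)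
  | |- test_mx (fun N => - @?F N) => apply (@test_mxN _ _ F)
  | |- test_mx (fun N => (@?F N)^T) => apply (@test_mx_tr _ _ F)
  | |- _ => assumption
  end.

(** * Second moments of trace functionals *)

Section Moments.
Variables (R : realType) (n : nat).
Variables (d : measure_display) (T : measurableType d) (P : probability T R).
Variable M : T -> 'M[R]_n.
Hypothesis haarM : haar_everywhere P M.
Local Notation Ex := (Ex P M).
Local Notation X := (@skew R n).
Implicit Types (S D N : 'M[R]_n).

Lemma haar_ibp_sum (F : 'M[R]_n -> R) (DF DDF : 'I_n -> 'I_n -> 'M[R]_n -> R)
    (phi dphi : R -> R) :
  test_fun F -> (forall i j, test_fun (DF i j)) -> (forall i j, test_fun (DDF i j)) ->
  (forall x : R, is_derive x 1 phi (dphi x)) -> continuous dphi ->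
  (forall i j N (t : R),
    is_derive t 1 (fun s => F (rot (X i j) s *m N)) (DF i j (rot (X i j) t *m N))) ->
  (forall i j N (t : R), is_derive t 1 (fun s => DF i j (rot (X i j) s *m N))
                                       (DDF i j (rot (X i j) t *m N))) ->
  Ex (fun N => dphi (F N) * (\sum_i \sum_j DF i j N ^+ 2)
               + phi (F N) * (\sum_i \sum_j DDF i j N)) = 0.
Proof.
move=> tF tDF tDDF dp cdp dF ddF.
have cp := is_derive1_continuous dp.
have tp := test_fun_comp cp tF.
have tdp := test_fun_comp cdp tF.
have tij i j : test_fun (fun N => dphi (F N) * DF i j N ^+ 2 + phi (F N) * DDF i j N).
  apply: test_funD; apply: test_funM => //; exact: test_funX.
transitivity (Ex (fun N => \sum_i \sum_j
    (dphi (F N) * DF i j N ^+ 2 + phi (F N) * DDF i j N))).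
  apply: (eq_Ex haarM) => N _; rewrite !mulr_sumr -big_split /=.
  by apply: eq_bigr => i _; rewrite !mulr_sumr -big_split.
rewrite (Ex_sum haarM); last by move=> i; apply: test_fun_sum => j.
apply: big1 => i _; rewrite (Ex_sum haarM) //.
apply: big1 => j _; apply: (haar_ibp haarM (skew_tr R i j) (skew_cube R i j)) => //.
Qed.

(** D is left free: C gives F, its transpose gives Tr(S^T B), and C^2 paired with S^2 gives the
    error term Tr(B^2 S^2). *)
Definition lin S D N := \tr (conjby D N *m S).

Lemma test_fun_lin S D : test_fun (lin S D).
Proof. by rewrite /lin; test_solve. Qed.

Lemma conj_tr D N : (conjby D N)^T = conjby D^T N.
Proof. by rewrite /conjby !trmx_mul trmxK mulmxA. Qed.

Lemma trace_conj D N : orthogonal_mx N -> \tr (conjby D N) = \tr D.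
Proof. by move=> oN; rewrite /conjby mxtrace_mulC mulmxA (mulmx1C oN) mul1mx. Qed.

Lemma conj_orthogonal D N :
  orthogonal_mx D -> orthogonal_mx N -> orthogonal_mx (conjby D N).
Proof.
by move=> oD oN; do 2?apply: orthogonal_mxM => //; exact: orthogonal_mx_tr.
Qed.

(** The gradient of [lin]: by cyclicity of the trace, the derivative in the direction X is Tr(X
    [B, S]). *)
Definition lin_grad S D N := conjby D N *m S - S *m conjby D N.

Lemma test_mx_lin_grad S D : test_mx (lin_grad S D).
Proof. by rewrite /lin_grad; test_solve. Qed.

Lemma lin_ibp S D (phi dphi : R -> R) : \tr D = 0 ->
  (forall x : R, is_derive x 1 phi (dphi x)) -> continuous dphi ->
  Ex (fun N => dphi (lin S D N) * (\sum_i \sum_j \tr (X i j *m lin_grad S D N) ^+ 2)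
    + phi (lin S D N) * (- 4 * (n%:R - 1) * lin S D N - 4 * lin S D^T N)) = 0.
Proof.
move=> D0 dp cdp.
pose ad i j B := X i j *m B - B *m X i j.
apply: etrans (@haar_ibp_sum (lin S D) (fun i j N => \tr (ad i j (conjby D N) *m S))
  (fun i j N => \tr (ad i j (ad i j (conjby D N)) *m S)) phi dphi _ _ _ dp cdp _ _).
- apply: (eq_Ex haarM) => N oN; congr (_ * _ + _ * _).
    apply: eq_bigr => i _; apply: eq_bigr => j _; congr (_ ^+ 2).
    rewrite /ad /lin_grad; move: (X i j) (conjby D N) => Z B.
    rewrite mulmxBl mulmxBr !mxtraceB !mulmxA; congr (_ - _).
    by rewrite mxtrace_mulC mulmxA.
  by rewrite sum_skew_bracket2 ?trace_conj // conj_tr.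
- exact: test_fun_lin.
- by move=> i j; rewrite /ad; test_solve.
- by move=> i j; rewrite /ad; test_solve.
- move=> i j N t; apply: is_derive_trace.
  have := mx_deriveM (mx_derive_conj D N t (skew_tr R i j) (skew_cube R i j))
    (mx_derive_cst t S).
  by rewrite mulmx0 addr0.
- move=> i j N t; apply: is_derive_trace.
  have dB := mx_derive_conj D N t (skew_tr R i j) (skew_cube R i j).
  have dX := mx_derive_cst t (X i j).
  have := mx_deriveM (mx_deriveB (mx_deriveM dX dB) (mx_deriveM dB dX))
    (mx_derive_cst t S).
  by rewrite !mulmx0 !mul0mx !addr0 !add0r.
Qed.

Lemma is_derive1_id (x : R) : is_derive x 1 (id : R -> R) ((fun=> 1) x).
Proof. exact: is_derive_id. Qed.

Lemma hs_lin_grad_le S D N : orthogonal_mx D -> orthogonal_mx N ->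
  hs (lin_grad S D N) <= 4 * hs S.
Proof.
move=> oD oN; have oB := conj_orthogonal oD oN.
rewrite /lin_grad; have := hsD_le (conjby D N *m S) (- (S *m conjby D N)).
rewrite hsN hs_orthol // hs_orthor //; lra.
Qed.

(** Integration by parts with [phi] the identity. The gradient sum is at most 4 * 4 [hs S], the
    cross term -4 F F' is at most 2 (F^2 + F'^2), F' being the functional of the transpose, and
    everything is divided by 4. *)
Lemma lin_sqr_le S D : orthogonal_mx D -> \tr D = 0 ->
  (n%:R - 1) * Ex (fun N => lin S D N ^+ 2) <= 4 * hs S
    + (Ex (fun N => lin S D N ^+ 2) + Ex (fun N => lin S D^T N ^+ 2)) / 2.
Proof.
move=> oD D0.
have c1 : continuous (fun _ : R => 1 : R) by move=> x; exact: cvg_cst.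
have E := lin_ibp S D0 is_derive1_id c1.
have t1 := test_fun_lin S D; have t2 := test_fun_lin S D^T.
have t3 := test_mx_lin_grad S D.
suff : 0 <= Ex (fun N => 16 * hs S + - 4 * (n%:R - 1) * lin S D N ^+ 2
    + 2 * (lin S D N ^+ 2 + lin S D^T N ^+ 2)).
  by do 5?[rewrite (ExD haarM) ?(ExZ haarM) ?Ex_cst; [|test_solve..]]; lra.
rewrite -E; apply: (le_Ex haarM); [by test_solve..|move=> N oN].
have := sum_skew_sqr_le (lin_grad S D N); have := hs_lin_grad_le S oD oN.
have := sqr_ge0 (lin S D N + lin S D^T N).
set q := \sum_i _; nra.
Qed.

(** The inequality for D involves the transpose of D and conversely. Adding the two gives (n - 2)(x
    + y) <= 8 [hs S], and the nonnegative y part is dropped. *)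
Lemma Ex_lin_sqr S D : (1 < n)%N -> orthogonal_mx D -> \tr D = 0 ->
  (n%:R - 2) * Ex (fun N => lin S D N ^+ 2) <= 8 * hs S.
Proof.
move=> n2 oD D0.
have D0' : \tr D^T = 0 by rewrite mxtrace_tr.
have := lin_sqr_le S (orthogonal_mx_tr oD) D0'; have := lin_sqr_le S oD D0.
rewrite trmxK; set x := Ex _; set y := Ex _ => h1 h2.
have : 0 <= (n%:R - 2) * y.
  apply: mulr_ge0; first by rewrite subr_ge0 (ler_nat _ 2).
  by apply: Rintegral_ge0 => w _; exact: sqr_ge0.
lra.
Qed.

End Moments.

Section QuadraticMoments.
Variables (R : realType) (n : nat).
Variables (d : measure_display) (T : measurableType d) (P : probability T R).
Variable M : T -> 'M[R]_n.
Hypothesis haarM : haar_everywhere P M.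
Local Notation Ex := (Ex P M).
Local Notation X := (@skew R n).
Variables (S1 S2 D1 D2 : 'M[R]_n) (a : R).
Hypotheses (S1_tr0 : \tr S1 = 0) (S2_tr0 : \tr S2 = 0).
Hypotheses (D1_tr0 : \tr D1 = 0) (D2_tr0 : \tr D2 = 0).
Hypotheses (S1_hs : hs S1 = a) (S2_hs : hs S2 = a).
Hypotheses (D1_orth : orthogonal_mx D1) (D2_orth : orthogonal_mx D2).
Local Notation B1 := (conjby D1).
Local Notation B2 := (conjby D2).
Implicit Type N : 'M[R]_n.

(** Two separate pairs cover both quadratic error terms, Tr(B S B S) and Tr(B S B^T S^T). *)
Definition quad N := \tr (B1 N *m S1 *m B2 N *m S2).

(** The product rule gives one commutator for each conjugated factor: [B1, S1 B2 S2] +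
    [B2, S2 B1 S1]. *)
Definition quad_grad N :=
  B1 N *m S1 *m B2 N *m S2 - S1 *m B2 N *m S2 *m B1 N
  + (B2 N *m S2 *m B1 N *m S1 - S2 *m B1 N *m S1 *m B2 N).

(** What the summed second derivative of [quad] leaves beside -8 (n - 1) [quad]: the first two
    traces are the transpose terms of the pure second derivatives, the rest is twice the mixed
    term. *)
Definition quad_rem N :=
  - 4 * \tr ((B1 N)^T *m (S1 *m B2 N *m S2))
  - 4 * \tr ((B2 N)^T *m (S2 *m B1 N *m S1))
  + 4 * (\tr ((B1 N *m S1)^T *m (B2 N *m S2)) - lin S1 D1 N * lin S2 D2 N
     + \tr ((S1 *m B2 N)^T *m (S2 *m B1 N)) - lin S1 D2 N * lin S2 D1 N
     - \tr ((B1 N *m S1 *m B2 N)^T *m S2) - \tr (S1^T *m (B2 N *m S2 *m B1 N))).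

Lemma test_fun_quad : test_fun quad.
Proof. by rewrite /quad; test_solve. Qed.

Lemma test_mx_quad_grad : test_mx quad_grad.
Proof. by rewrite /quad_grad; test_solve. Qed.

Lemma test_fun_quad_rem : test_fun quad_rem.
Proof.
have := test_fun_lin S1 D1; have := test_fun_lin S2 D2.
have := test_fun_lin S1 D2; have := test_fun_lin S2 D1 => *.
by rewrite /quad_rem; test_solve.
Qed.

Lemma quad_ibp :
  Ex (fun N => (\sum_i \sum_j \tr (X i j *m quad_grad N) ^+ 2)
    + quad N * (- 8 * (n%:R - 1) * quad N + quad_rem N)) = 0.
Proof.
pose ad i j (B : 'M[R]_n) := X i j *m B - B *m X i j.
pose DQ i j N := \tr (ad i j (B1 N) *m S1 *m B2 N *m S2)
  + \tr (B1 N *m S1 *m ad i j (B2 N) *m S2).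
pose DDQ i j N := \tr (ad i j (ad i j (B1 N)) *m S1 *m B2 N *m S2)
  + \tr (ad i j (B1 N) *m S1 *m ad i j (B2 N) *m S2)
  + (\tr (ad i j (B1 N) *m S1 *m ad i j (B2 N) *m S2)
  + \tr (B1 N *m S1 *m ad i j (ad i j (B2 N)) *m S2)).
have c1 : continuous (fun _ : R => 1 : R) by move=> x; exact: cvg_cst.
apply: etrans (@haar_ibp_sum _ _ _ _ _ _ haarM quad DQ DDQ id (fun=> 1)
  _ _ _ (@is_derive1_id R) c1 _ _).
- apply: (eq_Ex haarM) => N oN; rewrite mul1r; congr (_ + _ * _).
    apply: eq_bigr => i _; apply: eq_bigr => j _; congr (_ ^+ 2).
    rewrite /DQ /ad /quad_grad; move: (X i j) (B1 N) (B2 N) => Z U V.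
    have e1 := mxtrace_mulC U (Z *m S1 *m V *m S2).
    have e2 := mxtrace_mulC (U *m S1) (Z *m V *m S2).
    have e3 := mxtrace_mulC (U *m S1 *m V) (Z *m S2).
    rewrite !mulmxA in e1 e2 e3.
    rewrite !(mulmxBl, mulmxBr, mulmxDr) !(mxtraceB, mxtraceD) !mulmxA e1 e2 e3.
    by ring.
  rewrite /DDQ.
  (* Cyclic rotation brings the twice differentiated factor to the front, so that each pure part is
     a nested bracket against a fixed matrix. *)
  transitivity (\sum_i \sum_j \tr (ad i j (ad i j (B1 N)) *m (S1 *m B2 N *m S2))
    + \sum_i \sum_j \tr (ad i j (ad i j (B2 N)) *m (S2 *m B1 N *m S1))
    + 2 * \sum_i \sum_j \tr (ad i j (B1 N) *m S1 *m ad i j (B2 N) *m S2)).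
    rewrite sum_skew_bracket2 ?trace_conj // sum_skew_bracket2 ?trace_conj //.
    rewrite sum_skew_bracket_bracket // /quad_rem /quad /lin.
    move: (B1 N) (B2 N) => U V.
    have e1 := mxtrace_mulC (U *m S1) (V *m S2).
    rewrite (mxtrace_mulC S1 V) (mxtrace_mulC S2 U).
    rewrite !mulmxA in e1 *; rewrite -e1.
    by ring.
  rewrite mulr_sumr -!big_split /=; apply: eq_bigr => i _.
  rewrite mulr_sumr -!big_split /=; apply: eq_bigr => j _.
  have e1 := mxtrace_mulC (ad i j (ad i j (B2 N))) (S2 *m B1 N *m S1).
  have e2 := mxtrace_mulC S2 (B1 N *m S1 *m ad i j (ad i j (B2 N))).
  by rewrite e1 -!mulmxA in e2 *; rewrite e2; ring.
- exact: test_fun_quad.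
- by move=> i j; rewrite /DQ /ad; test_solve.
- by move=> i j; rewrite /DDQ /ad; test_solve.
- move=> i j N t.
  have d1 := mx_derive_conj D1 N t (skew_tr R i j) (skew_cube R i j).
  have d2 := mx_derive_conj D2 N t (skew_tr R i j) (skew_cube R i j).
  have := is_derive_trace (mx_deriveM (mx_deriveM (mx_deriveM d1
    (mx_derive_cst t S1)) d2) (mx_derive_cst t S2)).
  by move/is_derive_eq; apply; rewrite !mulmx0 !addr0 mulmxDl mxtraceD.
- move=> i j N t.
  have d1 := mx_derive_conj D1 N t (skew_tr R i j) (skew_cube R i j).
  have d2 := mx_derive_conj D2 N t (skew_tr R i j) (skew_cube R i j).
  have dX := mx_derive_cst t (X i j).
  have a1 := mx_deriveB (mx_deriveM dX d1) (mx_deriveM d1 dX).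
  have a2 := mx_deriveB (mx_deriveM dX d2) (mx_deriveM d2 dX).
  rewrite !mulmx0 !mul0mx !addr0 !add0r in a1 a2.
  have k1 := mx_derive_cst t S1; have k2 := mx_derive_cst t S2.
  have := is_derive1_add
    (is_derive_trace (mx_deriveM (mx_deriveM (mx_deriveM a1 k1) d2) k2))
    (is_derive_trace (mx_deriveM (mx_deriveM (mx_deriveM d1 k1) a2) k2)).
  move/is_derive_eq; apply; rewrite !mulmx0 !addr0.
  by rewrite !(mulmxDl (_ *m S1 *m _) _ S2) !(mxtraceD (_ *m S2)).
Qed.

(** Each of the four words has squared norm at most a^2, orthogonal factors at either end being
    free. Two uses of |P + Q|^2 <= 2 (|P|^2 + |Q|^2) give 4 * 4 a^2. *)
Lemma hs_quad_grad_le N : orthogonal_mx N -> hs (quad_grad N) <= 16 * a ^+ 2.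
Proof.
move=> oN.
have o1 := conj_orthogonal D1_orth oN; have o2 := conj_orthogonal D2_orth oN.
have h1 U V : orthogonal_mx U -> orthogonal_mx V -> hs (U *m S1 *m V *m S2) <= a ^+ 2.
  move=> oU oV; rewrite expr2 -{1}S1_hs -S2_hs -!mulmxA hs_orthol //.
  by apply: le_trans (hs_mul _ _) _; rewrite hs_orthol.
have h2 U V : orthogonal_mx U -> orthogonal_mx V -> hs (U *m S2 *m V *m S1) <= a ^+ 2.
  move=> oU oV; rewrite expr2 -{1}S2_hs -S1_hs -!mulmxA hs_orthol //.
  by apply: le_trans (hs_mul _ _) _; rewrite hs_orthol.
have h3 U V : orthogonal_mx U -> orthogonal_mx V -> hs (S1 *m U *m S2 *m V) <= a ^+ 2.
  move=> oU oV; rewrite expr2 -{1}S1_hs -S2_hs hs_orthor //.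
  by apply: le_trans (hs_mul _ _) _; rewrite hs_orthor.
have h4 U V : orthogonal_mx U -> orthogonal_mx V -> hs (S2 *m U *m S1 *m V) <= a ^+ 2.
  move=> oU oV; rewrite expr2 -{1}S2_hs -S1_hs hs_orthor //.
  by apply: le_trans (hs_mul _ _) _; rewrite hs_orthor.
apply: le_trans (hsD_le _ _) _.
have := hsD_le (B1 N *m S1 *m B2 N *m S2) (- (S1 *m B2 N *m S2 *m B1 N)).
have := hsD_le (B2 N *m S2 *m B1 N *m S1) (- (S2 *m B1 N *m S1 *m B2 N)).
rewrite !hsN.
have := h1 _ _ o1 o2; have := h2 _ _ o2 o1; have := h3 _ _ o2 o1; have := h4 _ _ o1 o2.
lra.
Qed.

Lemma quad_le N : orthogonal_mx N -> `|quad N| <= a.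
Proof.
move=> oN.
have o1 := conj_orthogonal D1_orth oN; have o2 := conj_orthogonal D2_orth oN.
by rewrite /quad -mulmxA; apply: trace_mulmx_norm_le; rewrite hs_orthol.
Qed.

(** The six bounded traces contribute 4 a each; the two products satisfy 4 |x y| <= 2 (x^2 +
    y^2). *)
Lemma quad_rem_arith (x1 x2 x3 x4 y1 y2 y3 y4 y5 y6 : R) :
  `|y1| <= a -> `|y2| <= a -> `|y3| <= a -> `|y4| <= a -> `|y5| <= a -> `|y6| <= a ->
  `|- 4 * y1 - 4 * y2 + 4 * (y3 - x1 * x2 + y4 - x3 * x4 - y5 - y6)| <=
    24 * a + 2 * (x1 ^+ 2 + x2 ^+ 2 + x3 ^+ 2 + x4 ^+ 2).
Proof.
have := sqr_ge0 (x1 + x2); have := sqr_ge0 (x1 - x2).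
have := sqr_ge0 (x3 + x4); have := sqr_ge0 (x3 - x4).
rewrite !sqrrD !sqrrN !mulrN => ? ? ? ?.
rewrite !ler_norml => /andP[? ?] /andP[? ?] /andP[? ?] /andP[? ?] /andP[? ?] /andP[? ?].
apply/andP; split; lra.
Qed.

Lemma quad_rem_le N : orthogonal_mx N ->
  `|quad_rem N| <= 24 * a + 2 * (lin S1 D1 N ^+ 2 + lin S2 D2 N ^+ 2
    + lin S1 D2 N ^+ 2 + lin S2 D1 N ^+ 2).
Proof.
move=> oN.
have o1 := conj_orthogonal D1_orth oN; have o2 := conj_orthogonal D2_orth oN.
apply: quad_rem_arith.
- rewrite -(mulmxA S1) (mulmxA _ S1).
  apply: trace_mulmx_norm_le; rewrite hs_orthol //.
  exact: orthogonal_mx_tr.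
- rewrite -(mulmxA S2) (mulmxA _ S2).
  apply: trace_mulmx_norm_le; rewrite hs_orthol //.
  exact: orthogonal_mx_tr.
- by apply: trace_tr_mulmx_norm_le; rewrite hs_orthol.
- by apply: trace_tr_mulmx_norm_le; rewrite hs_orthor.
- by apply: trace_tr_mulmx_norm_le => //; rewrite hs_orthor // hs_orthol.
- by apply: trace_tr_mulmx_norm_le => //; rewrite hs_orthor // hs_orthol.
Qed.

(** Improves the pathwise bound a^2 by a factor n - 1. The gradient gives 64 a^2, the bounded traces
    in the remainder give 24 a^2, and the four linear second moments, each at most 8 a because n - 2
    >= 1, give 2 a * 32 a. The total 152 a^2 is divided by 8. *)
Lemma Ex_quad_sqr : (2 < n)%N ->
  (n%:R - 1) * Ex (fun N => quad N ^+ 2) <= 19 * a ^+ 2.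
Proof.
move=> n3.
have tq := test_fun_quad; have tg := test_mx_quad_grad.
have tr := test_fun_quad_rem.
have t1 := test_fun_lin S1 D1; have t2 := test_fun_lin S2 D2.
have t3 := test_fun_lin S1 D2; have t4 := test_fun_lin S2 D1.
have a0 : 0 <= a by rewrite -S1_hs hs_ge0.
have n2 : (1 < n)%N by exact: ltnW.
have := Ex_lin_sqr haarM S1 n2 D1_orth D1_tr0.
have := Ex_lin_sqr haarM S2 n2 D2_orth D2_tr0.
have := Ex_lin_sqr haarM S1 n2 D2_orth D2_tr0.
have := Ex_lin_sqr haarM S2 n2 D1_orth D1_tr0.
rewrite S1_hs S2_hs => i4 i3 i2 i1.
suff : 0 <= Ex (fun N => 88 * a ^+ 2 + - 8 * (n%:R - 1) * quad N ^+ 2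
    + (2 * a) * (lin S1 D1 N ^+ 2 + lin S2 D2 N ^+ 2
      + lin S1 D2 N ^+ 2 + lin S2 D1 N ^+ 2)).
  do 6?[rewrite (ExD haarM) ?(ExZ haarM) ?Ex_cst; [|test_solve..]].
  have n1 : 1 <= n%:R - 2 :> R.
    by rewrite lerBrDr -[1 + 2]/(3%:R) ler_nat.
  move: i1 i2 i3 i4.
  move: (Ex (fun N => quad N ^+ 2)) (Ex (fun N => lin S1 D1 N ^+ 2))
    (Ex (fun N => lin S2 D2 N ^+ 2)) (Ex (fun N => lin S1 D2 N ^+ 2))
    (Ex (fun N => lin S2 D1 N ^+ 2)) => x y1 y2 y3 y4.
  have H y : (n%:R - 2) * y <= 8 * a -> y <= 8 * a.
    by move=> h; have [y0|/ltW y0] := leP y 0; nra.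
  move=> /H h1 /H h2 /H h3 /H h4; nra.
rewrite -quad_ibp; apply: (le_Ex haarM); [by test_solve..|move=> N oN].
have h1 := le_trans (sum_skew_sqr_le (quad_grad N))
  (ler_wpM2l (ler0n R 4) (hs_quad_grad_le oN)).
have h2 : quad N * quad_rem N <= a * (24 * a + 2 * (lin S1 D1 N ^+ 2 + lin S2 D2 N ^+ 2
    + lin S1 D2 N ^+ 2 + lin S2 D1 N ^+ 2)).
  apply: le_trans (ler_norm _) _; rewrite normrM; apply: ler_pM => //.
    exact: quad_le.
  exact: quad_rem_le.
move: h1 h2; set q := \sum_i _ => h1 h2; lra.
Qed.

End QuadraticMoments.

(** * Stein's equation *)

Section SteinEquation.
Variable R : realType.
Local Notation mu := (@lebesgue_measure R).
Local Notation p := (@normal_pdf R 0 1).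
Implicit Types x y : R.

Lemma std_pdfE x : p x = normal_peak 1 * expR (- (x ^+ 2 / 2)).
Proof.
by rewrite normal_pdfE ?oner_eq0 //= /normal_fun subr0 expr1n mulNr.
Qed.

Lemma std_pdf_gt0 x : 0 < p x.
Proof. by rewrite std_pdfE mulr_gt0 ?expR_gt0 // normal_peak_gt0 ?oner_eq0. Qed.

Lemma std_pdfN x : p (- x) = p x.
Proof. by rewrite !std_pdfE sqrrN. Qed.

Lemma is_derive_std_pdf x : is_derive x 1 p (- x * p x).
Proof.
rewrite (_ : p = fun t => normal_peak 1 * expR (- (t * t * 2^-1))); last first.
  by apply/funext => t; rewrite std_pdfE expr2.
have d1 := is_derive1_mul (is_derive_id x 1) (is_derive_id x 1).
have d2 := is_deriveN (is_derive1_mul d1 (is_derive_cst (2^-1 : R) x 1)).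
have d3 := is_derive1_comp (is_derive_expR _) d2.
have := is_derive1_mul (is_derive_cst (normal_peak 1 : R) x 1) d3.
by move/is_derive_eq; apply; rewrite /= mul0r add0r; field.
Qed.

Lemma continuous_std_pdf : continuous p.
Proof. exact: continuous_normal_pdf (oner_neq0 _). Qed.

Lemma cvg_std_pdf : p x @[x --> +oo%R] --> (0 : R).
Proof.
apply: (@squeeze_cvgr _ _ _ _ (cst 0) (fun x => normal_peak 1 * expR (- x))).
- near=> x; rewrite (ltW (std_pdf_gt0 _)) /= std_pdfE.
  rewrite ler_wpM2l ?normal_peak_ge0 // ler_expR lerN2.
  have : 2 <= x by near: x; exact: nbhs_pinfty_ge.
  nra.
- exact: cvg_cst.
rewrite -[X in _ --> X](mulr0 (normal_peak 1)).
apply: cvgM; [exact: cvg_cst|exact: cvgr_expR].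
Unshelve. all: by end_near. Qed.

Lemma std_pdf_integrable (D : set R) : measurable D ->
  mu.-integrable D (EFin \o p).
Proof.
move=> mD; apply: (@integrableS _ _ _ _ setT) => //.
exact: integrable_normal_pdf.
Qed.

Lemma std_pdfZ_integrable (c : R) (D : set R) : measurable D ->
  mu.-integrable D (EFin \o (fun x => c * p x)).
Proof.
move=> mD; have := @integrableZl _ _ _ mu D mD c _ (std_pdf_integrable mD).
by congr (integrable _ _ _); apply/funext => x.
Qed.

(** Mills ratio bound: on the tail x <= y, and y p(y) is the derivative of -p, so its integral is
    p(x). *)
Lemma std_pdf_tail_right x : 0 < x -> x * \int[mu]_(y in `[x, +oo[) p y <= p x.
Proof.
move=> x0.
rewrite -RintegralZl //; last exact: std_pdf_integrable.
have cyp : continuous (fun y => y * p y).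
  by move=> y; apply: cvgM; [exact: cvg_id|exact: continuous_std_pdf].
have E : (\int[mu]_(y in `[x, +oo[) (y * p y)%:E = (p x)%:E)%E.
  rewrite (@ge0_continuous_FTC2y _ (fun y => y * p y) (fun y => - p y) x 0).
  - by rewrite sub0e EFinN oppeK.
  - by move=> y xy; rewrite mulr_ge0 ?(ltW (std_pdf_gt0 _)) // (le_trans (ltW x0)).
  - exact: continuous_subspaceT.
  - by rewrite -[X in _ --> X]oppr0; apply: cvgN; exact: cvg_std_pdf.
  - move=> y _; apply: derivableN.
    exact: (@ex_derive _ _ _ _ _ _ _ (is_derive_std_pdf y)).
  - apply: cvgN; apply: cvg_at_right_filter; exact: continuous_std_pdf.
  - move=> y _; rewrite derive1E.
    have := is_deriveN (is_derive_std_pdf y) => -[_ ->].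
    by rewrite mulNr opprK.
rewrite -lee_fin -E /Rintegral fineK; last first.
  apply: integrable_fin_num => //.
  exact: std_pdfZ_integrable.
apply: ge0_le_integral => //=.
- by move=> y _; rewrite lee_fin mulr_ge0 ?(ltW x0) // ltW // std_pdf_gt0.
- apply/measurable_EFinP; apply: measurable_funM => //.
  apply: measurable_funS (@measurable_normal_pdf R 0 1) => //.
- apply/measurable_EFinP; apply: measurable_funS (continuous_measurable_fun cyp) => //.
- move=> y; rewrite in_itv /= andbT => xy; rewrite lee_fin ler_wpM2r //.
  by rewrite ltW // std_pdf_gt0.
Qed.

Lemma std_pdf_tail_left x : x < 0 -> - x * \int[mu]_(y in `]-oo, x]) p y <= p x.
Proof.
move=> x0; rewrite -std_pdfN.
have -> : \int[mu]_(y in `]-oo, x]) p y = \int[mu]_(y in `[- x, +oo[) p y.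
  rewrite /Rintegral -{1}[x]opprK ge0_integration_by_substitutionNy.
  - by congr fine; apply: eq_integral => y _ /=; rewrite std_pdfN.
  - by apply: continuous_subspaceT; exact: continuous_std_pdf.
  - by move=> y _; rewrite ltW // std_pdf_gt0.
by apply: std_pdf_tail_right; rewrite oppr_gt0.
Qed.

Section Solution.
Variables (h : R -> R) (K : R).
Hypotheses (ch : continuous h) (bh : forall x, `|h x| <= K).

(** Stein's equation g' - x g = h - m is equivalent to (g p)' = (h - m) p, so G / p is a
    solution. *)
Let m := \int[mu]_x (h x * p x).
Let k x := (h x - m) * p x.
Let G x := \int[mu]_(t in `]-oo, x]) k t.

Lemma bounded_pdf_integrable (u : R -> R) (C : R) (D : set R) : continuous u ->
  (forall x, `|u x| <= C) -> measurable D ->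
  mu.-integrable D (EFin \o (fun x => u x * p x)).
Proof.
move=> cu bu mD; apply: (@integrableS _ _ _ _ setT) => //.
have := integrableZl measurableT C (std_pdf_integrable measurableT).
apply: le_integrable => //.
  apply/measurable_EFinP; apply: measurable_funM.
    exact: continuous_measurable_fun.
  exact: measurable_normal_pdf.
move=> x _ /=; rewrite lee_fin !normrM ler_wpM2r //.
exact: le_trans (bu x) (ler_norm _).
Qed.

Let K0 : 0 <= K.
Proof. exact: le_trans (bh 0). Qed.

Let chm : continuous (fun x => h x - m).
Proof. by move=> x; apply: cvgB; [exact: ch|exact: cvg_cst]. Qed.

Let int_p : \int[mu]_x p x = 1.
Proof. by rewrite /Rintegral integral_normal_pdf. Qed.

Lemma normr_expect_le : `|m| <= K.
Proof.
apply: le_trans (le_normr_Rintegral _ _) _ => //.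
  exact: bounded_pdf_integrable bh _.
rewrite -[leRHS]mulr1 -[X in _ <= _ * X]int_p -RintegralZl //; last first.
  exact: std_pdf_integrable.
apply: le_Rintegral => //.
- exact: (integrable_abse (bounded_pdf_integrable ch bh measurableT)).
- exact: std_pdfZ_integrable.
move=> x _; rewrite normrM (gtr0_norm (std_pdf_gt0 x)) ler_wpM2r //.
by rewrite ltW // std_pdf_gt0.
Qed.

Let bhm x : `|h x - m| <= 2 * K.
Proof.
apply: le_trans (ler_normB _ _) _.
have := bh x; have := normr_expect_le; lra.
Qed.

Let ik (D : set R) : measurable D -> mu.-integrable D (EFin \o k).
Proof. exact: bounded_pdf_integrable bhm. Qed.

Let int_k : \int[mu]_x k x = 0.
Proof.
rewrite /k; under eq_Rintegral do rewrite mulrBl.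
rewrite RintegralB //; last 2 first.
- exact: bounded_pdf_integrable bh _.
- exact: std_pdfZ_integrable.
by rewrite RintegralZl //; [rewrite int_p mulr1 subrr|exact: std_pdf_integrable].
Qed.

Let le_int_k (D : set R) : measurable D ->
  `|\int[mu]_(t in D) k t| <= 2 * K * \int[mu]_(t in D) p t.
Proof.
move=> mD; apply: le_trans (le_normr_Rintegral _ _) _ => //; first exact: ik.
rewrite -RintegralZl //; last exact: std_pdf_integrable.
apply: le_Rintegral => //.
- exact: (integrable_abse (ik mD)).
- exact: std_pdfZ_integrable.
move=> x _; rewrite normrM (gtr0_norm (std_pdf_gt0 x)) ler_wpM2r //.
by rewrite ltW // std_pdf_gt0.
Qed.

(** As k has total integral zero, G is also minus the right tail. Each representation is small at
    its own end of the line. *)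
Let G_compl x : G x = - \int[mu]_(t in `[x, +oo[) k t.
Proof.
have := @Rintegral_itvB R k (BInfty _ true) (BInfty _ false) x.
rewrite (_ : [set` Interval -oo%O +oo%O] = setT); last first.
  by apply/seteqP; split => // y _; rewrite /= in_itv.
rewrite int_k sub0r -/(G x) => /(_ (ik measurableT) isT isT) E.
rewrite -Rintegral_itv_obnd_cbnd; last exact: ik.
by rewrite -E opprK.
Qed.

Let G_bound x : `|x| * `|G x| <= 2 * K * p x.
Proof.
have [x0|x0|->] := ltrgtP x 0; last first.
- by rewrite normr0 mul0r mulr_ge0 ?mulr_ge0 // ltW // std_pdf_gt0.
- rewrite G_compl normrN (gtr0_norm x0).
  apply: le_trans (ler_wpM2l (ltW x0) (le_int_k (measurable_itv _))) _.
  rewrite mulrCA; apply: ler_wpM2l; first by rewrite mulr_ge0.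
  exact: std_pdf_tail_right.
rewrite (ltr0_norm x0).
apply: le_trans (ler_wpM2l _ (le_int_k (measurable_itv _))) _.
  by rewrite oppr_ge0 ltW.
rewrite mulrCA; apply: ler_wpM2l; first by rewrite mulr_ge0.
exact: std_pdf_tail_left.
Qed.

(** The Mills bound gives |x g(x)| <= 2 K everywhere, which bounds g off [-1, 1]. The equation
    itself then bounds g' by |h - m| + |x g| <= 4 K. *)
Lemma stein_solution : exists (g dg : R -> R) (C : R),
  [/\ forall x : R, is_derive x 1 g (dg x), continuous dg,
      forall x, `|g x| <= C, forall x, `|dg x| <= C
    & forall x, dg x - x * g x = h x - m].
Proof.
have p0 x := std_pdf_gt0 x.
have ck : continuous k.
  by move=> x; apply: cvgM; [exact: chm|exact: continuous_std_pdf].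
have dG x : is_derive x 1 G (k x).
  have [] := @continuous_FTC1 R k (BInfty _ true) x (x + 1).
  - by rewrite ltrDl.
  - exact: ik.
  - by rewrite ltNyr.
  - exact: ck.
  by move=> dG eG; split => //; rewrite -derive1E.
pose g x := G x / p x.
pose dg x := h x - m + x * g x.
have dgP x : is_derive x 1 g (dg x).
  have pn : p x != 0 by rewrite gt_eqF.
  have dV : is_derive x 1 (fun t => (p t)^-1) (x / p x).
    have := is_deriveV pn (is_derive_std_pdf x).
    move/is_derive_eq; apply; rewrite /GRing.scale /=; field.
    exact: pn.
  have := is_derive1_mul (dG x) dV.
  move/is_derive_eq; apply; rewrite /dg /k /g; field.
  exact: pn.
have cg := is_derive1_continuous dgP.
have bxg x : `|x| * `|g x| <= 2 * K.
  rewrite /g normrM mulrA normfV (gtr0_norm (p0 x)) ler_pdivrMr //.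
(* Near 0 the bound on x g says nothing about g; continuity on a compact interval replaces it. *)
have [C1 bC1] : exists C, forall x, `|x| <= 1 -> `|g x| <= C.
  have cpt : compact (g @` `[- 1, 1]).
    apply: continuous_compact; last exact: segment_compact.
    exact: continuous_subspaceT.
  have [C [_ HC]] := compact_bounded cpt.
  exists (C + 1) => x xa; apply: (HC (C + 1)); first by rewrite ltrDl.
  by exists x => //=; rewrite in_itv /= -ler_norml.
have C10 : 0 <= C1 by apply: le_trans (bC1 0 _) => //; rewrite normr0.
have Kge0 := K0.
exists g, dg, (C1 + 4 * K); split => //.
- by move=> x; apply: cvgD; [exact: chm|apply: cvgM; [exact: cvg_id|exact: cg]].
- move=> x; have [x1|x1] := leP `|x| 1; first by have := bC1 x x1; lra.
  have := bxg x; have := normr_ge0 (g x); nra.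
- move=> x; apply: le_trans (ler_normD _ _) _; rewrite normrM.
  have := bxg x; have := bhm x; lra.
by move=> x; rewrite /dg addrK.
Qed.

End Solution.

End SteinEquation.

(** * Gaussian approximation *)

Section CycleMatrix.
Variable R : realType.

Lemma cycle_mx_orthogonal n : orthogonal_mx (cycle_mx R n).
Proof.
apply/matrixP => i j; rewrite !mxE (bigD1 (ordS i)) //= !mxE eqxx mul1r.
rewrite big1 ?addr0; first by rewrite (inj_eq (@ordS_inj n)).
by move=> k ki; rewrite !mxE (negbTE ki) mul0r.
Qed.

Lemma cycle_mx_trace n : (1 < n)%N -> \tr (cycle_mx R n) = 0.
Proof.
move=> n1; apply: big1 => i _; rewrite mxE; case: eqP => // /(congr1 val) /=.
have := ltn_ord i; rewrite leq_eqVlt => /predU1P[e|h]; last by rewrite modn_small //; lia.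
by rewrite e modnn; lia.
Qed.

(** A nonzero diagonal entry would need i + 2 = i modulo n. The case split follows where the index
    wraps around, at n - 1 or at n - 2. *)
Lemma cycle_mx_sqr_trace n : (2 < n)%N -> \tr (cycle_mx R n *m cycle_mx R n) = 0.
Proof.
move=> n2; apply: big1 => i _; rewrite mxE; apply: big1 => k _; rewrite !mxE.
case: eqP => [->|_]; last by rewrite mul0r.
case: eqP => [/(congr1 val)|_]; last by rewrite mulr0.
rewrite /= => e; exfalso; move: e; have := ltn_ord i.
rewrite leq_eqVlt => /predU1P[e|h].
  by rewrite e modnn modn_small; lia.
rewrite [(i.+1 %% n)%N]modn_small //; move: h.
rewrite leq_eqVlt => /predU1P[e|h]; last by rewrite modn_small //; lia.
by rewrite e modnn; lia.
Qed.

End CycleMatrix.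

Section Centering.
Variables (R : realType) (n : nat).
Implicit Types A : 'M[R]_n.

Definition centered A : 'M[R]_n := A - (\tr A / n%:R)%:M.

Lemma centered_trace A : (0 < n)%N -> \tr (centered A) = 0.
Proof.
move=> n0; have nn : n%:R != 0 :> R by rewrite pnatr_eq0 -lt0n.
by rewrite /centered mxtraceB mxtrace_scalar -[X in _ - X]mulr_natr divfK ?subrr.
Qed.

Lemma centered_hs A : (0 < n)%N -> \tr (A^T *m A) = n%:R ->
  hs (centered A) / n%:R = 1 - (\tr A / n%:R) ^+ 2.
Proof.
move=> n0 hA; have nn : n%:R != 0 :> R by rewrite pnatr_eq0 -lt0n.
rewrite /centered hsD hsN {1}/hs (mxtrace_mulC A) hA.
rewrite linearN /= tr_scalar_mx mulmxN mxtraceN mul_mx_scalar mxtraceZ.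
rewrite /hs tr_scalar_mx -scalar_mxM mxtrace_scalar -mulr_natr.
by field.
Qed.

Lemma centered_hs_le A : (0 < n)%N -> \tr (A^T *m A) = n%:R ->
  hs (centered A) <= n%:R.
Proof.
move=> n0 hA; have := centered_hs n0 hA.
have n0' : 0 < n%:R :> R by rewrite ltr0n.
move=> e; rewrite -[leRHS]mul1r -ler_pdivrMr // e.
by have := sqr_ge0 (\tr A / n%:R); lra.
Qed.

(** The square of Tr A is the off-diagonal sum plus the sum of the A_ii^2. The latter is at most
    |A|^2 = n, hence at most 1 / n after division by n^2. *)
Lemma centered_hs_dist A : (0 < n)%N -> \tr (A^T *m A) = n%:R ->
  `|hs (centered A) / n%:R -
    (1 - (n%:R ^+ 2)^-1 * \sum_(i < n) \sum_(j < n | i != j) A i i * A j j)|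
  <= n%:R^-1.
Proof.
move=> n0 hA; have n0' : 0 < n%:R :> R by rewrite ltr0n.
have nn : n%:R != 0 :> R by rewrite gt_eqF.
have e1 : (\tr A) ^+ 2 = \sum_i A i i ^+ 2 +
    \sum_(i < n) \sum_(j < n | i != j) A i i * A j j.
  rewrite expr2 /mxtrace big_distrlr /= -big_split /=; apply: eq_bigr => i _.
  rewrite (bigD1 i) //= expr2; congr (_ + _).
  by apply: eq_bigl => j; rewrite eq_sym.
have d0 : 0 <= \sum_i A i i ^+ 2 by apply: sumr_ge0 => i _; exact: sqr_ge0.
have dn : \sum_i A i i ^+ 2 <= n%:R.
  rewrite -hA mxtrace_mulC -/(hs A) hsE; apply: ler_sum => i _.
  by rewrite (bigD1 i) //= lerDl; apply: sumr_ge0 => j _; exact: sqr_ge0.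
rewrite centered_hs //.
have -> : 1 - (\tr A / n%:R) ^+ 2 - (1 - (n%:R ^+ 2)^-1 *
    \sum_(i < n) \sum_(j < n | i != j) A i i * A j j)
  = - ((\sum_i A i i ^+ 2) / n%:R ^+ 2).
  by rewrite expr_div_n e1; field.
rewrite normrN ger0_norm; last by rewrite divr_ge0 // sqr_ge0.
by rewrite ler_pdivrMr ?exprn_gt0 // expr2 mulrA mulVf // mul1r.
Qed.

Lemma trace_conj_centered A (D N : 'M[R]_n) : orthogonal_mx N -> \tr D = 0 ->
  \tr (A *m N *m D *m N^T) = lin (centered A) D N.
Proof.
move=> oN D0; rewrite /lin /centered mulmxBr mxtraceB mul_mx_scalar mxtraceZ.
by rewrite trace_conj // D0 mulr0 subr0 /conjby [RHS]mxtrace_mulC !mulmxA.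
Qed.

End Centering.

Section GaussianApproximation.
Variables (R : realType) (n : nat).
Variables (d : measure_display) (T : measurableType d) (P : probability T R).
Variable M : T -> 'M[R]_n.
Hypothesis haarM : haar_everywhere P M.
Variable S : 'M[R]_n.
Hypotheses (n_gt2 : (2 < n)%N) (S_tr0 : \tr S = 0) (S_hs : hs S <= n%:R).
Local Notation Ex := (Ex P M).
Local Notation C := (cycle_mx R n).
Local Notation X := (@skew R n).
Implicit Type N : 'M[R]_n.

Let F := lin S C.
Let F' := lin S C^T.
Let Q1 := quad S S C C.
Let Q2 := quad S S^T C C^T.
Let L := lin (S *m S) (C *m C).

Lemma conj_mul (D E N : 'M[R]_n) : orthogonal_mx N ->
  conjby D N *m conjby E N = conjby (D *m E) N.
Proof.
by move=> oN; rewrite /conjby !mulmxA -(mulmxA _ N^T) (mulmx1C oN) mulmx1.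
Qed.

(** For the commutator K = [B, S], |K|^2 = 2 |S|^2 - 2 Tr(B S B^T S^T) since B is orthogonal, and
    Tr(K^2) = 2 Tr(B S B S) - 2 Tr(B^2 S^2). *)
Lemma sum_skew_lin_grad N : orthogonal_mx N ->
  \sum_i \sum_j \tr (X i j *m lin_grad S C N) ^+ 2 =
  4 * (hs S - Q1 N - Q2 N + L N).
Proof.
move=> oN; rewrite sum_skew_sqr /Q1 /Q2 /L /quad /lin -conj_mul // -conj_tr.
have oB := conj_orthogonal (@cycle_mx_orthogonal R n) oN.
rewrite /lin_grad; move: (conjby C N) oB => B oB.
rewrite hsD hsN hs_orthol // hs_orthor // linearN /= mulmxN mxtraceN trmx_mul.
rewrite !(mulmxBl, mulmxBr) !mxtraceB !mulmxA.
have e2 := mxtrace_mulC S (B *m B *m S).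
have e3 := mxtrace_mulC (B *m S *m S) B.
have e4 := mxtrace_mulC S (B *m S *m B).
rewrite !mulmxA in e2 e3 e4.
by rewrite e3 e4 e2; ring.
Qed.

Let nR3 : 3 <= n%:R :> R.
Proof. by rewrite (ler_nat R 3 n). Qed.

Let tr0 : \tr C = 0.
Proof. by apply: cycle_mx_trace; exact: ltnW. Qed.

Let trT0 : \tr C^T = 0.
Proof. by rewrite mxtrace_tr. Qed.

Let oC : orthogonal_mx C.
Proof. exact: cycle_mx_orthogonal. Qed.

Let n_gt1 : (1 < n)%N.
Proof. exact: ltnW. Qed.

Let tF : test_fun F. Proof. exact: test_fun_lin. Qed.
Let tF' : test_fun F'. Proof. exact: test_fun_lin. Qed.
Let tL : test_fun L. Proof. exact: test_fun_lin. Qed.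
Let tQ1 : test_fun Q1. Proof. exact: test_fun_quad. Qed.
Let tQ2 : test_fun Q2. Proof. exact: test_fun_quad. Qed.

(** For n >= 3 one has n <= 3 (n - 2), which turns the constant 8 into 24. *)
Lemma Ex_F_sqr : Ex (fun N => F N ^+ 2) <= 24 * (hs S / n%:R).
Proof.
have := Ex_lin_sqr haarM S n_gt1 oC tr0; rewrite -/F => h.
have e0 : 0 <= Ex (fun N => F N ^+ 2).
  by apply: Rintegral_ge0 => w _; exact: sqr_ge0.
rewrite mulrA ler_pdivlMr ?ltr0n ?(ltnW n_gt1) //.
have n3 : 0 <= n%:R - 3 :> R by rewrite subr_ge0.
have := mulr_ge0 e0 n3; lra.
Qed.

(** The two quadratic terms give 38 n each, since 19 n^2 <= 38 n (n - 1). [L] gives 24 n because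
    [hs (S *m S)] is at most n^2, and the two linear terms give 24 each, rounded up to 24 n. *)
Let sqr_bound : Ex (fun N => Q1 N ^+ 2) + Ex (fun N => Q2 N ^+ 2)
  + Ex (fun N => L N ^+ 2) + Ex (fun N => F N ^+ 2) + Ex (fun N => F' N ^+ 2)
  <= 148 * n%:R.
Proof.
have oCT := orthogonal_mx_tr oC.
have trS0 : \tr S^T = 0 by rewrite mxtrace_tr.
have hST : hs S^T = hs S by rewrite hs_tr.
have a0 : 0 <= hs S by exact: hs_ge0.
have := Ex_quad_sqr haarM S_tr0 S_tr0 tr0 tr0 erefl erefl oC oC n_gt2.
have := Ex_quad_sqr haarM S_tr0 trS0 tr0 trT0 erefl hST oC oCT n_gt2.
have := Ex_lin_sqr haarM S n_gt1 oC tr0.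
have := Ex_lin_sqr haarM S n_gt1 oCT trT0.
have := Ex_lin_sqr haarM (S *m S) n_gt1 (orthogonal_mxM oC oC)
  (cycle_mx_sqr_trace R n_gt2).
have := hs_mul S S.
rewrite -/F -/F' -/Q1 -/Q2 -/L => hSS hL hF' hF hQ2 hQ1.
have pos (G : 'M[R]_n -> R) : 0 <= Ex (fun N => G N ^+ 2).
  by apply: Rintegral_ge0 => w _; exact: sqr_ge0.
have n3 : 0 <= n%:R - 3 :> R by rewrite subr_ge0.
have n0 : 0 < n%:R :> R by rewrite ltr0n (ltnW n_gt1).
have an : hs S * hs S <= n%:R * n%:R by apply: ler_pM.
have quadb (x : R) : (n%:R - 1) * x <= 19 * hs S ^+ 2 -> x <= 38 * n%:R.
  have n1 : 0 < n%:R - 1 :> R by lra.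
  move=> h; rewrite -(ler_pM2l n1); apply: le_trans h _; rewrite expr2.
  have := mulr_ge0 (ltW n0) n3; lra.
have linb (x y : R) : 0 <= y -> (n%:R - 2) * x <= 8 * y -> x * n%:R <= 24 * y.
  move=> y0 h; have [x0|/ltW x0] := leP x 0.
    by apply: (@le_trans _ _ 0); rewrite ?mulr_ge0 // mulr_le0_ge0 // ltW.
  have := mulr_ge0 x0 n3; lra.
have lin1 (x : R) : (n%:R - 2) * x <= 8 * hs S -> x <= 24.
  move/(linb _ _ a0) => h; rewrite -(ler_pM2r n0).
  by apply: le_trans h _; rewrite ler_wpM2l.
have h1 := quadb _ hQ1; have h2 := quadb _ hQ2.
have h3 := lin1 _ hF; have h4 := lin1 _ hF'.
have h5 : Ex (fun N => L N ^+ 2) <= 24 * n%:R.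
  rewrite -(ler_pM2r n0) -mulrA; apply: le_trans (linb _ _ (hs_ge0 _) hL) _.
  by rewrite ler_wpM2l // (le_trans hSS).
lra.
Qed.

(* The error terms have second moments of order [n]; [|x| <= r + x^2 / r] with
   [r = sqrt n] turns this into a first-moment bound of order [sqrt n]. *)
Lemma stein_discrepancy (phi dphi : R -> R) (K : R) :
  (forall x : R, is_derive x 1 phi (dphi x)) -> continuous dphi ->
  (forall x, `|phi x| <= K) -> (forall x, `|dphi x| <= K) ->
  `|Ex (fun N => hs S / n%:R * dphi (F N) - F N * phi (F N))|
    <= 153 * K / Num.sqrt n%:R.
Proof.
move=> dp cdp bp bdp.
have K0 : 0 <= K by exact: le_trans (bp 0).
have cp := is_derive1_continuous dp.
have tp := test_fun_comp cp tF; have tdp := test_fun_comp cdp tF.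
have n0 : 0 < n%:R :> R by rewrite ltr0n (ltnW n_gt1).
pose r : R := Num.sqrt n%:R.
have r0 : 0 < r by rewrite sqrtr_gt0.
have rr : r * r = n%:R by rewrite -expr2 sqr_sqrtr // ltW.
have E := lin_ibp haarM S tr0 dp cdp.
(* Writing (n - 1) F + F' as n F + (F' - F) makes n the coefficient of the main term; the difference
   joins the errors. *)
pose G N := dphi (F N) * (Q1 N + Q2 N - L N) + phi (F N) * (F' N - F N).
have tG : test_fun G by rewrite /G; test_solve.
have E2 : Ex (fun N => hs S / n%:R * dphi (F N) - F N * phi (F N)) = Ex G / n%:R.
  apply/(mulIf (lt0r_neq0 n0)); rewrite divfK ?lt0r_neq0 // mulrC -ExZ //; last first.
    by test_solve.
  apply/eqP; rewrite -subr_eq0 -mulN1r -(ExZ haarM) // -(ExD haarM); last 2 first.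
    by test_solve.
    by test_solve.
  rewrite -(mulr0 4^-1) -E -(ExZ haarM); last first.
    have t3 := test_mx_lin_grad S C; test_solve.
  apply/eqP/(eq_Ex haarM) => N oN; rewrite sum_skew_lin_grad // /G -/F -/F'.
  by field; rewrite lt0r_neq0.
have absb (x y z : R) : `|z| <= K -> `|x| <= y -> z * x <= K * y.
  by move=> h1 h2; apply: le_trans (ler_norm _) _; rewrite normrM ler_pM.
have sqb (x : R) : `|x| <= r + x ^+ 2 / r.
  rewrite -(ler_pM2r r0) mulrDl divfK ?lt0r_neq0 //.
  rewrite -(real_normK (num_real x)).
  have := sqr_ge0 (`|x| - r); have := mulr_ge0 (normr_ge0 x) (ltW r0); lra.
(* Each of the five errors costs r plus its square over r; with the bound 148 n on the squares the
   mean is at most K (5 r + 148 n / r) = 153 K r. *)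
pose W N := K * ((5 * r) +
  r^-1 * (Q1 N ^+ 2 + Q2 N ^+ 2 + L N ^+ 2 + F N ^+ 2 + F' N ^+ 2)).
have tW : test_fun W by rewrite /W; test_solve.
have GW N : `|G N| <= W N.
  apply: le_trans (ler_normD _ _) _; rewrite !normrM.
  have h1 : `|Q1 N + Q2 N - L N| <= `|Q1 N| + `|Q2 N| + `|L N|.
    by apply: le_trans (ler_normB _ _) _; rewrite lerD2r ler_normD.
  have h2 : `|F' N - F N| <= `|F' N| + `|F N| by exact: ler_normB.
  apply: le_trans (lerD (ler_pM _ _ (bdp (F N)) h1) (ler_pM _ _ (bp (F N)) h2)) _ => //.
  rewrite -mulrDr /W ler_wpM2l //.
  have := sqb (Q1 N); have := sqb (Q2 N); have := sqb (L N).
  have := sqb (F N); have := sqb (F' N); rewrite ![_ / r]mulrC; lra.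
have EW : Ex W <= 153 * K * r.
  rewrite /W (ExZ haarM); last by test_solve.
  rewrite (ExD haarM); [|by test_solve..].
  rewrite Ex_cst (ExZ haarM); last by test_solve.
  do 4![rewrite (ExD haarM); [|by test_solve..]].
  have h : r^-1 * (148 * n%:R) = 148 * r by rewrite -rr mulrCA mulKf ?lt0r_neq0.
  have := ler_wpM2l (ltW (_ : 0 < r^-1)) sqr_bound; rewrite invr_gt0 h => /(_ r0) h2.
  rewrite -mulrA [leRHS]mulrCA ler_wpM2l //; lra.
rewrite E2 normrM normfV (gtr0_norm n0) ler_pdivrMr //.
have -> : 153 * K / Num.sqrt n%:R * n%:R = 153 * K * r.
  by rewrite -/r -rr mulrA divfK ?lt0r_neq0.
apply: le_trans EW; rewrite ler_norml; apply/andP; split.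
  rewrite -mulN1r -(ExZ haarM) //; apply: (le_Ex haarM) => //; first by test_solve.
  by move=> N _; have := GW N; rewrite ler_norml mulN1r => /andP[].
by apply: (le_Ex haarM) => // N _; have := GW N; rewrite ler_norml => /andP[].
Qed.

End GaussianApproximation.

(** * Distance between the law of the trace and its Gaussian limit, for fixed n *)

Section TraceLaw.
Variables (R : realType) (n : nat).
Variables (d : measure_display) (T : measurableType d) (P : probability T R).
Variables (A : 'M[R]_n) (M : T -> 'M[R]_n).
Hypotheses (haarM : haar_orthogonal P M) (n_gt2 : (2 < n)%N).
Hypothesis A_norm : \tr (A^T *m A) = n%:R.
Local Notation C := (cycle_mx R n).
Local Notation S := (centered A).

Let n_gt0 : (0 < n)%N.
Proof. exact: leq_trans n_gt2. Qed.

Definition trace_expect (f : R -> R) : R :=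
  fine (\int[P]_w (f (\tr (A *m M w *m C *m (M w)^T)))%:E)%E.

(** The scalar part of A pairs with Tr C = 0, so A may be replaced by its centering. The same [M']
    serves every f, and the integral is finite, so [fine] loses nothing. *)
Lemma trace_expectE : exists M', haar_everywhere P M' /\
  forall f : R -> R, continuous f ->
    (\int[P]_w (f (\tr (A *m M w *m C *m (M w)^T)))%:E)%E = (trace_expect f)%:E /\
    trace_expect f = Ex P M' (fun N => f (lin S C N)).
Proof.
have [M' [haarM' eM']] := haar_orthogonal_everywhere haarM.
have C0 : \tr C = 0 by apply: cycle_mx_trace; exact: ltnW.
exists M'; split => // f cf; have [_ oM' _] := haarM'.
have tf : test_fun (fun N => f (\tr (A *m N *m C *m N^T))).
  by apply: test_fun_comp => //; test_solve.
have E : (\int[P]_w (f (\tr (A *m M w *m C *m (M w)^T)))%:E =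
    (Ex P M' (fun N => f (lin S C N)))%:E)%E.
  rewrite (eM' _ tf) /Ex /Rintegral fineK.
    by apply: eq_integral => w _; rewrite trace_conj_centered.
  apply: integrable_fin_num => //; 
  apply: (test_fun_integrable haarM' (F := fun N => f (lin S C N))).
  by apply: test_fun_comp => //; exact: test_fun_lin.
by rewrite /trace_expect E.
Qed.

(* Stein's equation for [h x = f (sqrt v * x)], rescaled by [sqrt v]. *)
Lemma trace_expect_dist (f g dg : R -> R) (v m K : R) : 0 < v -> continuous f ->
  (forall x : R, is_derive x 1 g (dg x)) -> continuous dg ->
  (forall x, `|g x| <= K) -> (forall x, `|dg x| <= K) ->
  (forall x, dg x - x * g x = f (Num.sqrt v * x) - m) ->
  `|trace_expect f - m| <= K / v * `|v - hs S / n%:R|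
    + 153 * (K + K / Num.sqrt v) / Num.sqrt v * (Num.sqrt n%:R)^-1.
Proof.
move=> v0 cf dgP cdg bg bdg stein.
have [M' [haarM' /(_ f cf)[_ ->]]] := trace_expectE.
pose s := Num.sqrt v; have s0 : 0 < s by rewrite sqrtr_gt0.
have ss : s ^+ 2 = v by rewrite sqr_sqrtr // ltW.
have sn0 : s != 0 by rewrite gt_eqF.
have nn : n%:R != 0 :> R by rewrite pnatr_eq0 -lt0n.
have K0 : 0 <= K by exact: le_trans (bg 0).
have Ks0 : 0 <= K / s by rewrite divr_ge0 // ltW.
pose phi x := g (s^-1 * x); pose dphi x := dg (s^-1 * x) * s^-1.
have dphiP (x : R) : is_derive x 1 phi (dphi x).
  have dl : is_derive x 1 (fun t => s^-1 * t) s^-1.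
    have := is_derive1_mul (is_derive_cst (s^-1 : R) x 1) (is_derive_id x 1).
    by move/is_derive_eq; apply; rewrite mul0r add0r mulr1.
  exact: (is_derive1_comp (dgP _) dl).
have cl : continuous (fun x => s^-1 * x).
  by move=> x; apply: cvgM; [exact: cvg_cst|exact: cvg_id].
have cdphi : continuous dphi.
  move=> x; apply: cvgM; last exact: cvg_cst.
  by apply: (@continuous_comp _ _ _ (fun x => s^-1 * x) dg); [exact: cl|exact: cdg].
have bphi x : `|phi x| <= K + K / s by apply: le_trans (bg _) _; rewrite lerDl.
have bdphi0 x : `|dphi x| <= K / s.
  rewrite /dphi normrM normfV (gtr0_norm s0) ler_wpM2r // invr_ge0 ltW //.
have bdphi x : `|dphi x| <= K + K / s.
  by apply: le_trans (bdphi0 _) _; rewrite lerDr.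
have := stein_discrepancy haarM' n_gt2 (centered_trace A n_gt0)
  (centered_hs_le n_gt0 A_norm) dphiP cdphi bphi bdphi.
have tF := test_fun_lin S C; move: tF; set F := lin S C => tF D1.
have tphi : test_fun (fun N => phi (F N)).
  by apply: test_fun_comp => //; exact: is_derive1_continuous dphiP.
have tdphi : test_fun (fun N => dphi (F N)) by exact: test_fun_comp.
have tf : test_fun (fun N => f (F N)) by exact: test_fun_comp.
have bE : `|Ex P M' (fun N => dphi (F N))| <= K / s.
  rewrite ler_norml; apply/andP; split.
    rewrite -(Ex_cst P M' (- (K / s))); apply: (le_Ex haarM') => //.
      by test_solve.
    by move=> N _; have := bdphi0 (F N); rewrite ler_norml => /andP[].
  rewrite -(Ex_cst P M' (K / s)); apply: (le_Ex haarM') => //.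
    by test_solve.
  by move=> N _; have := bdphi0 (F N); rewrite ler_norml => /andP[].
(* With F / s in Stein's equation, g' - x g becomes s^-1 (v phi'(F) - F phi(F)); replacing v by
   |S|^2 / n splits off the variance error. *)
have E : Ex P M' (fun N => f (F N)) - m = s^-1 *
    ((v - hs S / n%:R) * Ex P M' (fun N => dphi (F N))
     + Ex P M' (fun N => hs S / n%:R * dphi (F N) - F N * phi (F N))).
  rewrite -(ExZ haarM') // -(ExD haarM'); [|by test_solve..].
  rewrite -(ExZ haarM'); last by test_solve.
  rewrite -[X in _ - X](Ex_cst P M' m) -mulN1r -(ExZ haarM'); last by test_solve.
  rewrite -(ExD haarM'); [|by test_solve..].
  apply: (eq_Ex haarM') => N _; have := stein (s^-1 * F N).
  rewrite mulrA -/s divff // mul1r mulN1r => <-.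
  by rewrite /dphi /phi -ss; field; rewrite sn0 nn.
rewrite E normrM normfV (gtr0_norm s0).
rewrite -/s; apply: le_trans (ler_wpM2l _ (ler_normD _ _)) _.
  by rewrite invr_ge0 ltW.
rewrite mulrDr; apply: lerD.
  rewrite normrM mulrA mulrC.
  have -> : K / v * `|v - hs S / n%:R| = K / s * (s^-1 * `|v - hs S / n%:R|).
    by rewrite -ss; field.
  by apply: ler_wpM2r => //; rewrite mulr_ge0 // invr_ge0 ltW.
apply: le_trans (ler_wpM2l _ D1) _; first by rewrite invr_ge0 ltW.
by rewrite mulrC -!mulrA [(Num.sqrt _)^-1 * _]mulrC.
Qed.

(** Chebyshev's argument: where |F| >= del, the difference is at most 2 K <= 2 K F^2 / del^2. The
    constant 48 is 2 times the 24 in the second moment of F. *)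
Lemma trace_expect_dist0 (f : R -> R) (K e del : R) : continuous f ->
  (forall x, `|f x| <= K) -> 0 < del ->
  (forall x, `|x| < del -> `|f x - f 0| <= e) -> 0 <= e ->
  `|trace_expect f - f 0| <= e + 48 * K / del ^+ 2 * (hs S / n%:R).
Proof.
move=> cf bf del0 fe e0.
have [M' [haarM' /(_ f cf)[_ ->]]] := trace_expectE.
have F2 := Ex_F_sqr haarM' S n_gt2.
have tF := test_fun_lin S C; move: tF F2; set F := lin S C => tF F2.
have tf : test_fun (fun N => f (F N)) by exact: test_fun_comp.
have K0 : 0 <= K by exact: le_trans (bf 0).
have d2 : 0 < del ^+ 2 by rewrite exprn_gt0.
pose W N := e + 2 * K / del ^+ 2 * F N ^+ 2.
have tW : test_fun W by rewrite /W; test_solve.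
have fW N : `|f (F N) - f 0| <= W N.
  rewrite /W; have [lt|ge] := ltP `|F N| del.
    apply: le_trans (fe _ lt) _; rewrite lerDl mulr_ge0 ?sqr_ge0 // divr_ge0 //.
      by rewrite mulr_ge0.
    exact: ltW.
  apply: (@le_trans _ _ (2 * K)).
    apply: le_trans (ler_normB _ _) _; have := bf (F N); have := bf 0; lra.
  apply: (@le_trans _ _ (2 * K / del ^+ 2 * F N ^+ 2)); last by rewrite lerDr.
  rewrite -mulrA ler_peMr ?mulr_ge0 // mulrC ler_pdivlMr // mul1r.
  rewrite -(real_normK (num_real (F N))) ler_pXn2r // nnegrE //.
  exact: ltW.
have EW : Ex P M' W <= e + 48 * K / del ^+ 2 * (hs S / n%:R).
  rewrite /W (ExD haarM'); [|by test_solve..].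
  rewrite Ex_cst lerD2l (ExZ haarM'); last by test_solve.
  have k0 : 0 <= 2 * K / del ^+ 2 by rewrite divr_ge0 ?mulr_ge0 // ltW.
  apply: le_trans (ler_wpM2l k0 F2) _.
  by rewrite le_eqVlt; apply/orP; left; apply/eqP; ring.
have -> : Ex P M' (fun N => f (F N)) - f 0 = Ex P M' (fun N => f (F N) - f 0).
  rewrite (ExD haarM') ?Ex_cst //; by test_solve.
apply: le_trans EW; rewrite ler_norml; apply/andP; split.
  rewrite -mulN1r -(ExZ haarM') //; apply: (le_Ex haarM') => //; [by test_solve..|].
  by move=> N _; have := fW N; rewrite ler_norml mulN1r => /andP[].
apply: (le_Ex haarM') => //; first by test_solve.
by move=> N _; have := fW N; rewrite ler_norml => /andP[].
Qed.

End TraceLaw.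

(** * Passage to the limit *)

Lemma cvg_inv_sqrt_nat (R : realType) :
  (fun n : nat => (Num.sqrt (n%:R : R))^-1) @ \oo --> (0 : R).
Proof.
apply/cvgrPdist_lt => e e0; near=> n.
have n0 : 0 < n%:R :> R by rewrite ltr0n; near: n; exact: nbhs_infty_gt.
rewrite sub0r normrN ger0_norm ?invr_ge0 ?sqrtr_ge0 //.
rewrite -[ltRHS]invrK ltf_pV2 ?posrE ?invr_gt0 ?sqrtr_gt0 //.
rewrite -(ger0_norm (ltW (_ : 0 < e^-1))) ?invr_gt0 // -sqrtr_sqr ltr_sqrt //.
by near: n; exact: nbhs_infty_gtr.
Unshelve. all: by end_near. Qed.

Lemma cvg_inv_nat (R : realType) : (fun n : nat => (n%:R : R)^-1) @ \oo --> (0 : R).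
Proof.
rewrite -[X in _ --> X](mulr0 (0 : R)).
apply: cvg_trans (cvgM (@cvg_inv_sqrt_nat R) (@cvg_inv_sqrt_nat R)).
apply: near_eq_cvg; apply: nearW => n /=.
by rewrite -invfM -expr2 sqr_sqrtr // ler0n.
Qed.

Lemma cvg_centered_hs (R : realType) (A : forall n : nat, 'M[R]_n) (c : R) :
  (forall n, \tr ((A n)^T *m A n) = n%:R) ->
  (fun n : nat => (n%:R ^+ 2)^-1 *
      \sum_(i < n) \sum_(j < n | i != j) A n i i * A n j j) @ \oo --> c ->
  (fun n => hs (centered (A n)) / n%:R) @ \oo --> 1 - c.
Proof.
move=> hA hc; set s := (fun n : nat => _) in hc.
have h1 : (fun n => 1 - s n) @ \oo --> 1 - c by apply: cvgB => //; exact: cvg_cst.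
have h2 : (fun n => hs (centered (A n)) / n%:R - (1 - s n)) @ \oo --> (0 : R).
  apply/cvgr0Pnorm_lt => e e0; near=> n.
  have n0 : (0 < n)%N by near: n; exact: nbhs_infty_gt.
  apply: le_lt_trans (centered_hs_dist n0 (hA n)) _.
  near: n; have /cvgr0Pnorm_lt/(_ e e0) := @cvg_inv_nat R.
  by apply: filterS => n; rewrite ger0_norm // invr_ge0.
rewrite -[X in _ --> X]addr0 [X in _ --> X]addrC.
apply: cvg_trans (cvgD h2 h1); apply: near_eq_cvg; apply: nearW => n /=.
by rewrite subrK.
Unshelve. all: by end_near. Qed.

Theorem theorem3p2 (R : realType) (A : forall n : nat, 'M[R]_n) (c : R)
  (d : nat -> measure_display) (T : forall n : nat, measurableType (d n))
  (P : forall n : nat, probability (T n) R)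
  (M : forall n : nat, T n -> 'M[R]_n) :
  (forall n, \tr ((A n)^T *m A n) = n%:R) ->
  (fun n : nat => (n%:R ^+ 2)^-1 *
      \sum_(i < n) \sum_(j < n | i != j) A n i i * A n j j) @ \oo --> c ->
  (forall n, haar_orthogonal (P n) (M n)) ->
  forall f : R -> R, bounded_continuous f ->
    (fun n : nat => (\int[P n]_w
        (f (\tr (A n *m M n w *m cycle_mx R n *m (M n w)^T)))%:E)%E)
      @ \oo --> normal_expect (1 - c) f.
Proof.
move=> hA hc haarM f [cf [K bf]].
pose a n := hs (centered (A n)) / n%:R.
have ca : a @ \oo --> 1 - c by exact: cvg_centered_hs.
have a0 n : 0 <= a n by rewrite divr_ge0 ?hs_ge0.
(* The limiting variance is nonnegative as a limit of |S|^2 / n. *)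
have v0 : 0 <= 1 - c.
  by apply: (cvgr_to_ge ca); exact: nearW.
move: (1 - c) ca v0 => v ca v0 {hc c}.
pose h x := f (Num.sqrt v * x).
have ch : continuous h.
  move=> x; apply: (@continuous_comp _ _ _ (fun x => Num.sqrt v * x) f); last exact: cf.
  by apply: cvgM; [exact: cvg_cst|exact: cvg_id].
have bh x : `|h x| <= K by exact: bf.
pose m := \int[lebesgue_measure]_x (h x * normal_pdf 0 1 x).
have -> : normal_expect v f = m%:E.
  rewrite /normal_expect /m /Rintegral fineK //.
  apply: integrable_fin_num => //.
  exact: (bounded_pdf_integrable ch bh measurableT).
pose E n := trace_expect (P n) (A n) (M n) f.
suff cE : E @ \oo --> m.
  have cE' : (fun n => (E n)%:E) @ \oo --> m%:E.
    by apply: cvg_EFin => //; exact: nearW.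
  apply: cvg_trans cE'; apply: near_eq_cvg; near=> n.
  have n2 : (2 < n)%N by near: n; exact: nbhs_infty_gt.
  by have [M' [_ /(_ f cf)[-> _]]] := trace_expectE (A n) (haarM n) n2.
apply/cvgrPdist_lt => e e0.
(* The bound from Stein's equation carries negative powers of v, so the degenerate limit, a point
   mass at 0, is treated through the second moment. *)
have [vE|vn0] := eqVneq v 0.
  have mE : m = f 0.
    rewrite /m /h vE sqrtr0; under eq_Rintegral do rewrite mul0r.
    rewrite RintegralZl //; last exact: std_pdf_integrable.
    by rewrite /Rintegral integral_normal_pdf /= mulr1.
  have e2 : 0 < e / 2 by rewrite divr_gt0.
  have [del /= del0 Hdel] := (cvgrPdist_lt _ _).1 (cf 0) _ e2.
  have fe x : `|x| < del -> `|f x - f 0| <= e / 2.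
    by move=> xd; rewrite distrC ltW //; apply: Hdel; rewrite /= sub0r normrN.
  near=> n.
  have n2 : (2 < n)%N by near: n; exact: nbhs_infty_gt.
  rewrite distrC mE.
  apply: le_lt_trans (trace_expect_dist0 (A n) (haarM n) n2 cf bf del0 fe (ltW e2)) _.
  rewrite -/(a n) [ltRHS](splitr e) ltrD2l.
  near: n.
  have : (fun n => 48 * K / del ^+ 2 * a n) @ \oo --> (0 : R).
    rewrite -[X in _ --> X](mulr0 (48 * K / del ^+ 2)) -vE.
    by apply: cvgM => //; exact: cvg_cst.
  move/cvgr0Pnorm_lt/(_ _ e2); apply: filterS => n.
  exact: le_lt_trans (ler_norm _).
have {vn0}vgt0 : 0 < v by rewrite lt_neqAle eq_sym vn0.
have [g [dg [C [dgP cdg bg bdg stein]]]] := stein_solution ch bh.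
near=> n.
have n2 : (2 < n)%N by near: n; exact: nbhs_infty_gt.
rewrite distrC.
apply: le_lt_trans (trace_expect_dist (haarM n) n2 (hA n) vgt0 cf dgP cdg bg bdg stein) _.
rewrite -/(a n); near: n.
set k1 := C / v; set k2 := 153 * _ / _.
have : (fun n => k1 * `|v - a n| + k2 * (Num.sqrt n%:R)^-1) @ \oo --> (0 : R).
  rewrite -[X in _ --> X](addr0 (0 : R)); apply: cvgD.
    rewrite -[X in _ --> X](mulr0 k1); apply: cvgM; first exact: cvg_cst.
    rewrite -(normr0 R) -(subrr v); apply: cvg_norm.
    by apply: cvgB => //; exact: cvg_cst.
  rewrite -[X in _ --> X](mulr0 k2); apply: cvgM; first exact: cvg_cst.
  exact: cvg_inv_sqrt_nat.
move/cvgr0Pnorm_lt/(_ e e0); apply: filterS => n.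
exact: le_lt_trans (ler_norm _).
Unshelve. all: by end_near. Qed.
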